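(* For every $x\in\Lambda_{\log}(\mathbb{Z}_+)$ there exists an operator $a\in B(L_2(-\pi,\pi))$ such that $\mu(a)=\mu(x)$ and $$\mu(T(a))\geq \frac{1}{8\pi}\,S_d\mu(x),$$ i.e. $\mu(n,a)=\mu(n,x)$ and $\mu(n,T(a))\geq \frac{1}{8\pi}(S_d\mu(x))(n)$ for every $n\in\mathbb{Z}_+$. Here $T$ is the triangular truncation operator and $S_d$ is the discrete Calderón operator.
   Context: $\mathbb{Z}_+=\{0,1,2,\dots\}$. For a bounded complex sequence $x$ indexed by a countable set, $\mu(x)=(\mu(n,x))_{n\in\mathbb{Z}_+}$ denotes the decreasing rearrangement of $|x|$, i.e. $\mu(n,x)=\inf\{\sup_{k\notin F}|x(k)| : F \text{ finite},\ |F|\le n\}$. $B(L_2(-\pi,\pi))$ is the algebra of all bounded linear operators on the Hilbert space $L_2(-\pi,\pi)$. For a bounded operator $A$, $\mu(A)=(\mu(n,A))_{n\in\mathbb{Z}_+}$ is its singular value sequence, $\mu(n,A)=\inf\{\|A(1-e)\| : e \text{ an orthogonal projection of rank}\le n\}$. $\Lambda_{\log}(\mathbb{Z}_+)$ is the space of all bounded sequences $x$ on $\mathbb{Z}_+$ with $\|x\|_{\Lambda_{\log}}=\sum_{n\ge 0}\frac{\mu(n,x)}{n+1}<\infty$. $\Lambda_{\log}(B(L_2(-\pi,\pi)))$ is the ideal of all bounded operators $A$ on $L_2(-\pi,\pi)$ with $\|A\|_{\Lambda_{\log}}=\sum_{n\geq 0}\frac{\mu(n,A)}{n+1}<\infty$.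 In particular, an operator $a$ with $\mu(a)=\mu(x)$, $x\in\Lambda_{\log}(\mathbb{Z}_+)$, belongs to this ideal. Triangular truncation $T$: if $A$ is an integral operator on $L_2(-\pi,\pi)$ with kernel $K$, i.e. $(Af)(t)=\int_{-\pi}^{\pi}K(t,s)f(s)\,ds$, then $T(A)$ is the integral operator $$(T(A)f)(t)=\int_{-\pi}^{\pi}\mathrm{sgn}(t-s)K(t,s)f(s)\,ds,\quad t\in(-\pi,\pi),\ f\in L_2(-\pi,\pi).$$ It is known that $T$ is bounded from $\Lambda_{\log}(B(L_2(-\pi,\pi)))$ to $B(L_2(-\pi,\pi))$. On this ideal $T$ is understood as the unique bounded linear extension from the Hilbert–Schmidt operators (which are integral operators with square-integrable kernels and are dense in the ideal). The discrete Calderón operator is $$(S_dx)(n)=\frac{1}{n+1}\sum_{k=0}^{n}x(k)+\sum_{k=n}^{\infty}\frac{x(k)}{k+1},\quad n\in\mathbb{Z}_+,\ x\in\Lambda_{\log}(\mathbb{Z}_+).$$ *)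

(* Defs.v *)
From HB Require Import structures.
From mathcomp Require Import all_boot all_order all_algebra finmap.
From mathcomp Require Import complex.
From mathcomp Require Import all_classical all_reals all_analysis.

Set Implicit Arguments.
Unset Strict Implicit.
Unset Printing Implicit Defensive.

Import Order.TTheory GRing.Theory Num.Theory.
Import numFieldNormedType.Exports.
Import ComplexField.Normc.

Local Open Scope classical_set_scope.
Local Open Scope ring_scope.
Local Open Scope complex_scope.
Local Open Scope quotient_scope.

Section SquareIntegrable.
Context (R : realType).

Definition Ipi : set (measurableTypeR R) := [set` `]- pi, (pi : R)[%R].

Lemma measurable_Ipi : measurable Ipi.
Proof. exact: measurable_itv. Qed.

Lemma lebesgue_Ipi_fin : (lebesgue_measure Ipi < +oo)%E.
Proof.
by rewrite lebesgue_measure_itv /=; case: ifP => // _; rewrite -EFinD ltry.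
Qed.

Definition leb_pi : set (measurableTypeR R) -> \bar R :=
  mfrestr measurable_Ipi lebesgue_Ipi_fin.

HB.instance Definition _ := FiniteMeasure.on leb_pi.

Definition sq_integrable d (X : measurableType d)
    (m : {measure set X -> \bar R}) (f : X -> R[i]) : Prop :=
  (fun t => complex.Re (f t)) \in Lfun m 2%:E /\ (fun t => complex.Im (f t)) \in Lfun m 2%:E.

Definition L2pred : {pred R -> R[i]} := [pred f | `[<sq_integrable leb_pi f>]].

Lemma L2pred_submod : submod_closed L2pred.
Proof.
have l12 : (1 <= 2%:E :> \bar R)%E by rewrite lee_fin ler1n.
pose F := Lfun leb_pi 2%:E.
have [F0 FL] := Lfun_submod_closed leb_pi l12.
have FD f g : f \in F -> g \in F -> (f : R -> R) + g \in F.
  by move=> Ff Fg; rewrite -[f]scale1r; exact: FL.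
have FZ (c : R) f : f \in F -> c *: (f : R -> R) \in F.
  by move=> Ff; rewrite -[_ *: _]addr0; exact: FL.
split; first by apply/asboolP; split.
move=> [a b] f g /asboolP[rf jf] /asboolP[rg jg]; apply/asboolP; split.
- rewrite (_ : (fun t => _) = (a *: (fun t => complex.Re (f t)) +
      (- b) *: (fun t => complex.Im (f t))) + (fun t => complex.Re (g t)) :> (R -> R)).
    exact: (FD _ _ (FD _ _ (FZ a _ rf) (FZ (- b) _ jf)) rg).
  apply/funext => t /=; rewrite !fctE.
  by case: (f t) => u v; case: (g t) => w z /=; rewrite scaleNr.
- rewrite (_ : (fun t => _) = (a *: (fun t => complex.Im (f t)) +
      b *: (fun t => complex.Re (f t))) + (fun t => complex.Im (g t)) :> (R -> R)).
    exact: (FD _ _ (FD _ _ (FZ a _ jf) (FZ b _ rf)) jg).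
  apply/funext => t /=; rewrite !fctE.
  by case: (f t) => u v; case: (g t) => w z /=.
Qed.

HB.instance Definition _ := GRing.isSubmodClosed.Build R[i] (R -> R[i]) L2pred
  L2pred_submod.

Record L2fun := MkL2fun { L2val :> R -> R[i]; _ : L2val \in L2pred }.

HB.instance Definition _ := [isSub for L2val].
HB.instance Definition _ := [Choice of L2fun by <:].
HB.instance Definition _ := [SubChoice_isSubLmodule of L2fun by <:].

Definition ae_zero : {pred L2fun} :=
  [pred f : L2fun | `[<{ae leb_pi, forall t, f t = 0}>]].

Lemma ae_zero_submod : submod_closed ae_zero.
Proof.
split; first by apply/asboolP/aeW.
move=> c f g /asboolP f0 /asboolP g0; apply/asboolP.
apply: (@filterS2 _ _ (ae_filter_ringOfSetsType leb_pi) _ _ _ _ f0 g0).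
by move=> t /= ft gt; rewrite !fctE ft gt scaler0 addr0.
Qed.

HB.instance Definition _ := GRing.isSubmodClosed.Build R[i] L2fun ae_zero
  ae_zero_submod.

(* Complex L_2(-pi, pi). Representatives are functions on the whole line, but
   [leb_pi] does not charge the complement of ]-pi, pi[. *)
Definition L2 := Quotient.quot ae_zero.
HB.instance Definition _ := GRing.Zmodule.on L2.
HB.instance Definition _ := EqQuotient.on L2.

Definition L2fct (u : L2) : R -> R[i] := repr u.

Lemma L2_pi_scale (c : R[i]) (f : L2fun) :
  \pi_L2 (c *: repr (\pi_L2 f)) = \pi_L2 (c *: f).
Proof.
apply/eqP; rewrite -Quotient.idealrBE -scalerBr rpredZ//.
by rewrite Quotient.idealrBE reprK.
Qed.

Definition L2_scale (c : R[i]) (u : L2) : L2 := \pi_L2 (c *: repr u).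

Lemma L2_scaleA c d u : L2_scale c (L2_scale d u) = L2_scale (c * d) u.
Proof. by rewrite /L2_scale L2_pi_scale scalerA. Qed.

Lemma L2_scale1 : left_id 1 L2_scale.
Proof. by move=> u; rewrite /L2_scale scale1r reprK. Qed.

Lemma L2_pi_add (f g : L2fun) : \pi_L2 (f + g) = \pi_L2 f + \pi_L2 g.
Proof. exact: Quotient.pi_add. Qed.

Lemma L2_scaleDr : right_distributive L2_scale +%R.
Proof.
move=> c; elim/quotW => f; elim/quotW => g.
by rewrite -L2_pi_add /L2_scale !L2_pi_scale scalerDr L2_pi_add.
Qed.

Lemma L2_scaleDl u : {morph L2_scale^~ u : c d / c + d}.
Proof. by move=> c d; rewrite /L2_scale scalerDl L2_pi_add. Qed.

HB.instance Definition _ := GRing.Zmodule_isLmodule.Build R[i] L2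
  L2_scaleA L2_scale1 L2_scaleDr L2_scaleDl.

Definition cintegral (f : R -> R[i]) : R[i] :=
  (\int[leb_pi]_t complex.Re (f t)) +i* (\int[leb_pi]_t complex.Im (f t)).

Definition inner (u v : L2) : R[i] :=
  cintegral (fun t => L2fct u t * (L2fct v t)^*).

Definition L2norm (u : L2) : R :=
  Num.sqrt (\int[leb_pi]_t (normc (L2fct u t)) ^+ 2).

End SquareIntegrable.

Section Operators.
Context (R : realType).
Implicit Types A e : L2 R -> L2 R.

Definition bounded_op A : Prop :=
  linear A /\ exists M : R, forall u, L2norm (A u) <= M * L2norm u.

Definition opnorm A : R := sup [set L2norm (A u) | u in [set u | L2norm u <= 1]].

Definition orth_proj e : Prop :=
  [/\ linear e, forall u, e (e u) = e u & forall u v, inner (e u) v = inner u (e v)].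

Definition rank_le (n : nat) e : Prop :=
  exists v : 'I_n -> L2 R, forall u, exists c : 'I_n -> R[i],
    e u = \sum_i c i *: v i.

Definition singular_value A (n : nat) : R :=
  inf [set opnorm (fun u => A (u - e u)) | e in [set e | orth_proj e /\ rank_le n e]].

Definition rearrangement (x : nat -> R[i]) (n : nat) : R :=
  inf [set sup [set normc (x k) | k in [set k | k \notin F]]
      | F in [set F : {fset nat} | (#|` F| <= n)%N]].

(* [log_sum (rearrangement x)] and [log_sum (singular_value A)] are the
   Lambda_log norms of [x] and [A]. *)
Definition log_sum (y : nat -> R) : \bar R :=
  (\sum_(0 <= n <oo) (y n / n.+1%:R)%:E)%E.

Definition Lambda_log_seq (x : nat -> R[i]) : Prop :=
  (exists M : R, forall k, normc (x k) <= M) /\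
  (log_sum (rearrangement x) < +oo)%E.

Definition Lambda_log_op A : Prop :=
  bounded_op A /\ (log_sum (singular_value A) < +oo)%E.

Definition Calderon (y : nat -> R) (n : nat) : R :=
  n.+1%:R^-1 * (\sum_(0 <= k < n.+1) y k)
  + limn (fun N => \sum_(n <= k < N) y k / k.+1%:R).

Definition kernel_of (K : R * R -> R[i]) A : Prop :=
  forall u, {ae @leb_pi R, forall t,
    L2fct (A u) t = cintegral (fun s => K (t, s) * L2fct u s)}.

(* The bounded linear extension to the ideal [Lambda_log_op] of the truncation
   of Hilbert-Schmidt operators, i.e. of the operators with a square-integrable
   kernel. These are dense in the ideal, hence [T] is determined on it; the
   values of [T] outside the ideal are irrelevant. *)
Definition triangular_truncation (T : (L2 R -> L2 R) -> L2 R -> L2 R) : Prop :=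
  [/\ forall A, Lambda_log_op A -> bounded_op (T A),
      forall (c : R[i]) A B, Lambda_log_op A -> Lambda_log_op B ->
        T (c *: A + B) = c *: T A + T B,
      exists C : R, forall A, Lambda_log_op A ->
        ((opnorm (T A))%:E <= C%:E * log_sum (singular_value A))%E
    & forall K A,
        sq_integrable (@leb_pi R \x @leb_pi R)%E K -> kernel_of K A ->
        kernel_of (fun ts => (Num.sg (ts.1 - ts.2))%:C * K ts) (T A)].

End Operators.

(* Main.v *)
Require Import Defs.
From mathcomp Require Import all_boot all_order all_algebra finmap.
From mathcomp Require Import complex.
From mathcomp Require Import all_classical all_reals all_analysis.
From mathcomp Require Import measurable_realfun.
From mathcomp Require Import ring lra.

Set Implicit Arguments.
Unset Strict Implicit.
Unset Printing Implicit Defensive.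

Import Order.TTheory GRing.Theory Num.Theory.
Import numFieldNormedType.Exports.
Import ComplexField.Normc.

Local Open Scope classical_set_scope.
Local Open Scope ring_scope.
Local Open Scope complex_scope.
Local Open Scope quotient_scope.

(** Let [s] be the decreasing rearrangement of [x], and on (-pi, pi) consider two
    orthonormal families: the half-integer exponentials [half_exp], i.e.
    e^(i(n+1/2)t) / sqrt(2 pi), and the integer ones [int_exp], i.e.
    e^(-ikt) / sqrt(2 pi), for n, k >= 0. The operator [a] is diagonal with
    entries [s] in the first family; so its singular values are [s].

    On a finite section of [a] the truncation is explicit. The kernel is a
    combination of the functions e^(i(n+1/2)(t-s)), which are 2pi-antiperiodic in
    t - s; multiplying such a function by sgn(t - s) makes it 2pi-periodic, so the
    truncated operator is diagonalised by the integer exponentials. Concretely,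
    for w = n + 1/2 + k one has cos(w pi) = 0, hence
      int_(-pi)^pi sgn(t - s) e^(-iws) ds = (2i / w) e^(-iwt)
    ([cintegral_sg_cexp]), and the truncation of the N-th section maps the k-th
    integer exponential to i/pi * sum_(n < N) s_n / (n + 1/2 + k) times itself
    ([truncated_eigenvector]). These moduli decrease in k, so the k-th one bounds
    the k-th singular value from below, and comparing n + 1/2 + k with
    2 max(n + 1, k + 1) bounds it from below by a multiple of the Calderon sum cut
    at N ([calderon_head_le], [calderon_tail_le]).

    To pass to the limit in N, the remainder of [a] after its N-th section is again
    diagonal, with entries s_(n+N), and sum_n s_(n+N) / (n + 1) tends to 0
    ([log_sum_shift_small]); by the boundedness of [T] the truncation of the
    remainder tends to 0 in operator norm ([opnorm_truncation_remainder]).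

    Two general facts carry the rest. A singular value is at least [d] as soon as
    the operator expands by [d] on the span of n + 1 orthonormal vectors, because a
    projection of rank n kills some vector of this span ([singular_value_ge]). And
    the diagonal operator exists because L_2 is complete ([L2_complete]): its
    partial sums are Cauchy, with rate [s]. *)

(** * Integration of complex-valued functions *)

Section ComplexIntegral.
Context (R : realType).
Local Notation mu := (@leb_pi R).
Implicit Types f g : R -> R[i].

Lemma aeS (P Q : R -> Prop) : (forall t, P t -> Q t) ->
  {ae mu, forall t, P t} -> {ae mu, forall t, Q t}.
Proof. by move=> PQ; apply: (@filterS _ _ (ae_filter_ringOfSetsType mu)). Qed.

Lemma aeS2 (P Q S : R -> Prop) : (forall t, P t -> Q t -> S t) ->
  {ae mu, forall t, P t} -> {ae mu, forall t, Q t} -> {ae mu, forall t, S t}.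
Proof. by move=> PQ; apply: (@filterS2 _ _ (ae_filter_ringOfSetsType mu)). Qed.

Definition cintegrable f :=
  mu.-integrable setT (EFin \o (fun t => complex.Re (f t)))
  /\ mu.-integrable setT (EFin \o (fun t => complex.Im (f t))).

Lemma cintegrableD f g : cintegrable f -> cintegrable g ->
  cintegrable (fun t => f t + g t).
Proof.
move=> [f1 f2] [g1 g2]; split.
- apply: (eq_integrable measurableT _ _ _ (integrableD measurableT f1 g1)) => // t _ /=.
  by case: (f t) => a b; case: (g t).
- apply: (eq_integrable measurableT _ _ _ (integrableD measurableT f2 g2)) => // t _ /=.
  by case: (f t) => a b; case: (g t).
Qed.

Lemma cintegrableZ (c : R[i]) f : cintegrable f ->
  cintegrable (fun t => c * f t).
Proof.
case: c => a b [f1 f2]; split.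
- have := integrableB measurableT (integrableZl measurableT a f1)
    (integrableZl measurableT b f2).
  by apply: eq_integrable => // t _ /=; case: (f t) => x y /=.
- have := integrableD measurableT (integrableZl measurableT a f2)
    (integrableZl measurableT b f1).
  by apply: eq_integrable => // t _ /=; case: (f t) => x y /=.
Qed.

Lemma cintegralD f g : cintegrable f -> cintegrable g ->
  cintegral (fun t => f t + g t) = cintegral f + cintegral g.
Proof.
move=> [f1 f2] [g1 g2]; rewrite /cintegral; apply/eqP; rewrite eq_complex /=.
rewrite -!RintegralD//; apply/andP; split; apply/eqP; apply: eq_Rintegral => t _.
- by case: (f t) => ? ?; case: (g t).
- by case: (f t) => ? ?; case: (g t).
Qed.

Lemma cintegralZ (c : R[i]) f : cintegrable f ->
  cintegral (fun t => c * f t) = c * cintegral f.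
Proof.
case: c => a b [f1 f2]; rewrite /cintegral; apply/eqP; rewrite eq_complex /=.
have i1 := integrableZl measurableT a f1.
have i2 := integrableZl measurableT b f2.
have i3 := integrableZl measurableT a f2.
have i4 := integrableZl measurableT b f1.
rewrite -!RintegralZl//; apply/andP; split; apply/eqP.
- rewrite -RintegralB//; apply: eq_Rintegral => t _.
  by case: (f t) => ? ?.
- rewrite -RintegralD//; apply: eq_Rintegral => t _.
  by case: (f t) => ? ?.
Qed.

Lemma cintegral_conj f : cintegrable f ->
  cintegral (fun t => (f t)^*%R) = (cintegral f)^*%R.
Proof.
move=> [f1 f2]; rewrite /cintegral; apply/eqP; rewrite eq_complex /=.
apply/andP; split; apply/eqP.
- by apply: eq_Rintegral => t _; case: (f t).
- rewrite -[RHS]mulN1r -RintegralZl//; apply: eq_Rintegral => t _.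
  by case: (f t) => ? ? /=; rewrite mulN1r.
Qed.

Definition cmeasurable f :=
  measurable_fun [set: measurableTypeR R] (fun t => complex.Re (f t) : R)
  /\ measurable_fun [set: measurableTypeR R] (fun t => complex.Im (f t) : R).

Lemma cintegrable_measurable f : cintegrable f -> cmeasurable f.
Proof.
by move=> [/measurable_int/measurable_EFinP ? /measurable_int/measurable_EFinP ?].
Qed.

Lemma ae_eq_cintegral f g : cmeasurable f -> cmeasurable g ->
  {ae mu, forall t, f t = g t} -> cintegral f = cintegral g.
Proof.
move=> [f1 f2] [g1 g2] fg; rewrite /cintegral; congr (_ +i* _); congr fine.
- apply: ae_eq_integral => //.
  + exact/measurable_EFinP.
  + exact/measurable_EFinP.
  + by apply: aeS fg => t -> _.
- apply: ae_eq_integral => //.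
  + exact/measurable_EFinP.
  + exact/measurable_EFinP.
  + by apply: aeS fg => t -> _.
Qed.

Lemma L2pred_cmeasurable f : f \in @L2pred R -> cmeasurable f.
Proof.
move=> /asboolP[/andP[]]; rewrite inE => m1 _ /andP[]; rewrite inE => m2 _.
by split.
Qed.

Lemma cmeasurableM f g : cmeasurable f -> cmeasurable g ->
  cmeasurable (fun t => f t * g t).
Proof.
move=> [f1 f2] [g1 g2]; split.
- rewrite (_ : (fun _ => _) = (fun t => complex.Re (f t) * complex.Re (g t) -
    complex.Im (f t) * complex.Im (g t))); last first.
    by apply/funext => t; case: (f t); case: (g t).
  by apply: measurable_funB; apply: measurable_funM.
- rewrite (_ : (fun _ => _) = (fun t => complex.Re (f t) * complex.Im (g t) +
    complex.Im (f t) * complex.Re (g t))); last first.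
    by apply/funext => t; case: (f t); case: (g t).
  by apply: measurable_funD; apply: measurable_funM.
Qed.

Lemma cmeasurable_conj f : cmeasurable f -> cmeasurable (fun t => (f t)^*%R).
Proof.
move=> [f1 f2]; split.
- by rewrite (_ : (fun _ => _) = (fun t => complex.Re (f t)))//; apply/funext => t; case: (f t).
- rewrite (_ : (fun _ => _) = (fun t => - complex.Im (f t))); last first.
    by apply/funext => t; case: (f t).
  exact: measurableT_comp.
Qed.

Lemma cintegrable_mul_conj f g : f \in @L2pred R -> g \in @L2pred R ->
  cintegrable (fun t => f t * (g t)^*%R).
Proof.
move=> /asboolP[f1 f2] /asboolP[g1 g2].
have H (u v : R -> R) : u \in Lfun mu 2%:E -> v \in Lfun mu 2%:E ->
    mu.-integrable setT (EFin \o (u \* v)).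
  by move=> lu lv; apply/Lfun1_integrable; exact: Lfun2_mul_Lfun1.
split.
- apply: eq_integrable (integrableD measurableT (H _ _ f1 g1) (H _ _ f2 g2)) => // t _ /=.
  by case: (f t) => ? ?; case: (g t) => ? ? /=; rewrite mulrN opprK.
- apply: eq_integrable (integrableB measurableT (H _ _ f2 g1) (H _ _ f1 g2)) => // t _ /=.
  by case: (f t) => ? ?; case: (g t) => ? ? /=; rewrite mulrN EFinD EFinN addeC.
Qed.

End ComplexIntegral.

(** * The inner product of L_2(-pi, pi) *)

Arguments inner {R} : simpl never.
Arguments cintegral {R} : simpl never.

Section L2Inner.
Context (R : realType).
Local Notation mu := (@leb_pi R).
Implicit Types (u v w : L2 R) (c : R[i]).

Lemma L2fctP u : L2fct u \in @L2pred R.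
Proof. by rewrite /L2fct; case: (repr u). Qed.

(** A class is evaluated through a chosen representative, which agrees with the
    function that defines the class only outside a null set. All pointwise rules
    below are therefore almost everywhere statements. *)
Lemma L2fct_pi (f : L2fun R) :
  {ae mu, forall t, L2fct (\pi_(L2 R) f) t = f t}.
Proof.
have : repr (\pi_(L2 R) f) - f \in @ae_zero R.
  by rewrite Quotient.idealrBE reprK.
move=> /asboolP; apply: aeS => t /= /eqP.
by rewrite !fctE subr_eq0 => /eqP.
Qed.

Lemma L2fctD u v :
  {ae mu, forall t, L2fct (u + v) t = L2fct u t + L2fct v t}.
Proof.
rewrite -[u in (u + v)]reprK -[v in (_ + v)]reprK -L2_pi_add.
exact: L2fct_pi.
Qed.

Lemma L2fctZ c u : {ae mu, forall t, L2fct (c *: u) t = c * L2fct u t}.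
Proof. exact: L2fct_pi. Qed.

Lemma L2_ext u v : {ae mu, forall t, L2fct u t = L2fct v t} -> u = v.
Proof.
move=> uv; rewrite -[u]reprK -[v]reprK; apply/eqP.
rewrite -Quotient.idealrBE; apply/asboolP.
by apply: aeS uv => t /= uv; rewrite !fctE; apply/eqP; rewrite subr_eq0; apply/eqP.
Qed.

Lemma L2fct_cmeas u : cmeasurable (L2fct u).
Proof. exact/L2pred_cmeasurable/L2fctP. Qed.

Lemma L2mul_cmeas u v : cmeasurable (fun t => L2fct u t * (L2fct v t)^*%R).
Proof. by apply: cmeasurableM; [|apply: cmeasurable_conj]; exact: L2fct_cmeas. Qed.

Lemma inner_linear v : linear_for *%R (fun u => inner u v).
Proof.
move=> c u w; rewrite /inner.
have Hu := cintegrable_mul_conj (L2fctP u) (L2fctP v).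
have Hw := cintegrable_mul_conj (L2fctP w) (L2fctP v).
rewrite -cintegralZ// -cintegralD//; last exact: cintegrableZ.
apply: ae_eq_cintegral.
- exact: L2mul_cmeas.
- by apply: cintegrable_measurable; apply: cintegrableD => //; exact: cintegrableZ.
- apply: aeS2 (L2fctD (c *: u) w) (L2fctZ c u) => t -> ->.
  by rewrite mulrDl mulrA.
Qed.

Lemma inner_conj u v : inner v u = (inner u v)^*%R.
Proof.
rewrite /inner -cintegral_conj; last exact: cintegrable_mul_conj (L2fctP u) (L2fctP v).
by congr cintegral; apply/funext => t; rewrite rmorphM/= conjCK mulrC.
Qed.

Lemma innerDl u v w : inner (u + v) w = inner u w + inner v w.
Proof. by have := inner_linear w 1 u v; rewrite scale1r mul1r. Qed.

Lemma innerZl c u w : inner (c *: u) w = c * inner u w.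
Proof.
have := inner_linear w (-1) 0 0; rewrite scaleN1r oppr0 addr0 mulN1r addNr => i0.
by have := inner_linear w c u 0; rewrite !addr0 i0 addr0.
Qed.

Let conjCD (x y : R[i]) : (x + y)^*%R = x^*%R + y^*%R.
Proof. exact: rmorphD. Qed.

Let conjCM (x y : R[i]) : (x * y)^*%R = x^*%R * y^*%R.
Proof. exact: rmorphM. Qed.

Lemma innerDr u v w : inner w (u + v) = inner w u + inner w v.
Proof. by rewrite inner_conj innerDl conjCD -(inner_conj u w) -(inner_conj v w). Qed.

Lemma innerZr c u w : inner w (c *: u) = c^*%R * inner w u.
Proof. by rewrite inner_conj innerZl conjCM -(inner_conj u w). Qed.

Lemma normc_sqr (z : R[i]) :
  normc z ^+ 2 = complex.Re z ^+ 2 + complex.Im z ^+ 2.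
Proof. by case: z => a b /=; rewrite sqr_sqrtr// addr_ge0// sqr_ge0. Qed.

Lemma normc_ge0 (z : R[i]) : 0 <= normc z.
Proof. by case: z => a b /=; exact: sqrtr_ge0. Qed.

Lemma normc_real (x : R) : 0 <= x -> normc x%:C = x.
Proof. by move=> x0; rewrite /= expr0n /= addr0 sqrtr_sqr ger0_norm. Qed.

Lemma conj_realC (x : R) : (x%:C)^*%R = x%:C :> R[i].
Proof. by apply/eqP; rewrite eq_complex /= oppr0 !eqxx. Qed.

Lemma measurable_normc_sqr (f : R -> R[i]) : cmeasurable f ->
  measurable_fun [set: measurableTypeR R] (fun t => normc (f t) ^+ 2).
Proof.
move=> [m1 m2]; rewrite (_ : (fun _ => _) = (fun t => complex.Re (f t) ^+ 2 +
    complex.Im (f t) ^+ 2)); last by apply/funext => t; rewrite normc_sqr.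
by apply: measurable_funD; exact: measurable_funX.
Qed.

Lemma inner_self u : inner u u = (L2norm u ^+ 2)%:C.
Proof.
rewrite /L2norm sqr_sqrtr; last by apply: Rintegral_ge0 => t _; rewrite sqr_ge0.
rewrite /inner /cintegral; apply/eqP; rewrite eq_complex/=; apply/andP; split; apply/eqP.
- apply: eq_Rintegral => t _; rewrite normc_sqr; case: (L2fct u t) => a b /=.
  by rewrite mulrN opprK !expr2.
- rewrite /Rintegral; under eq_integral.
    move=> t _; rewrite (_ : complex.Im _ = 0); last first.
      by case: (L2fct u t) => a b /=; rewrite mulrN addrC mulrC subrr.
    over.
  by rewrite integral0.
Qed.

Lemma L2norm_ge0 u : 0 <= L2norm u.
Proof. exact: sqrtr_ge0. Qed.

Lemma L2norm_integral u :
  (L2norm u ^+ 2)%:E = (\int[mu]_t ((normc (L2fct u t)) ^+ 2)%:E)%E.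
Proof.
rewrite /L2norm sqr_sqrtr; last by apply: Rintegral_ge0 => t _; rewrite sqr_ge0.
rewrite /Rintegral fineK// ; apply: integrable_fin_num => //.
have [i1 _] := cintegrable_mul_conj (L2fctP u) (L2fctP u).
apply: eq_integrable i1 => // t _ /=; rewrite normc_sqr.
by case: (L2fct u t) => a b /=; rewrite mulrN opprK !expr2.
Qed.

Lemma L2norm_eq0 u : L2norm u = 0 -> u = 0.
Proof.
move=> u0.
have m : measurable_fun [set: measurableTypeR R] (fun t => (normc (L2fct u t) ^+ 2)%:E).
  by apply/measurable_EFinP; apply: measurable_normc_sqr; exact: L2fct_cmeas.
have := L2norm_integral u; rewrite u0 expr0n/= => /esym.
have e : (\int[mu]_t ((normc (L2fct u t)) ^+ 2)%:E =
    \int[mu]_t `|((normc (L2fct u t)) ^+ 2)%:E|)%E.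
  by apply: eq_integral => t _; rewrite gee0_abs// lee_fin sqr_ge0.
rewrite e => /(ae_eq_integral_abs mu measurableT m) h.
apply: L2_ext; apply: aeS2 h (L2fctZ 0 0) => t /= /(_ I) [] h.
rewrite scale0r mul0r => ->.
by apply: eq0_normc; apply/eqP; rewrite -sqrf_eq0 h.
Qed.

End L2Inner.

(** * Orthonormal families *)

Section Hilbert.
Context (R : realType).
Implicit Types (u v : L2 R) (c : R[i]).

Lemma inner0l v : inner 0 v = 0.
Proof. by rewrite -(scale0r (0 : L2 R)) innerZl mul0r. Qed.

Lemma inner_suml (I : Type) (r : seq I) (F : I -> L2 R) v :
  inner (\sum_(i <- r) F i) v = \sum_(i <- r) inner (F i) v.
Proof.
by apply: (big_morph (fun u => inner u v)) => [x y|]; rewrite ?innerDl ?inner0l.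
Qed.

Lemma L2normZ c u : L2norm (c *: u) = normc c * L2norm u.
Proof.
apply: (@pexpIrn _ 2) => //; rewrite ?nnegrE ?mulr_ge0 ?L2norm_ge0 ?normc_ge0//.
apply: complexI; rewrite -inner_self innerZl innerZr inner_self mulrA -sqr_normc.
rewrite normc_def -rmorphXn -[LHS](rmorphM (real_complex R)) exprMn; congr _%:C.
by congr (_ * _); case: c => a b.
Qed.

Lemma L2norm0 : L2norm (0 : L2 R) = 0.
Proof. by rewrite -(scale0r (0 : L2 R)) L2normZ normc0 mul0r. Qed.

Lemma L2normN u : L2norm (- u) = L2norm u.
Proof. by rewrite -scaleN1r L2normZ normcN normc1 mul1r. Qed.

Lemma pythagoras u v : inner u v = 0 ->
  L2norm (u + v) ^+ 2 = L2norm u ^+ 2 + L2norm v ^+ 2.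
Proof.
move=> uv; have vu : inner v u = 0 by rewrite inner_conj uv rmorph0.
apply: complexI; rewrite -inner_self innerDl !innerDr uv vu addr0 add0r !inner_self.
by rewrite -(rmorphD (real_complex R)).
Qed.

Definition orthonormal_family (w : nat -> L2 R) :=
  forall i j, inner (w i) (w j) = (i == j)%:R.

Lemma inner_orthonormal_sum w (a : nat -> R[i]) (r : seq nat) i :
  orthonormal_family w -> uniq r ->
  inner (\sum_(j <- r) a j *: w j) (w i) = if i \in r then a i else 0.
Proof.
move=> ow; elim: r => [|k r IH] /=; first by rewrite big_nil inner0l.
move=> /andP[kr /IH{}IH]; rewrite big_cons innerDl innerZl IH ow in_cons.
case: (eqVneq k i) kr => [->|ik] kr; first by rewrite (negbTE kr) mulr1 addr0.
by rewrite mulr0 add0r.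
Qed.

Lemma L2norm_orthonormal_sum w (a : nat -> R[i]) (r : seq nat) :
  orthonormal_family w -> uniq r ->
  L2norm (\sum_(j <- r) a j *: w j) ^+ 2 = \sum_(j <- r) normc (a j) ^+ 2.
Proof.
move=> ow; elim: r => [|k r IH] /=; first by rewrite !big_nil L2norm0 expr0n.
move=> /andP[kr ur]; rewrite !big_cons addrC pythagoras; last first.
  by rewrite innerZr inner_orthonormal_sum// (negbTE kr) mulr0.
rewrite IH// addrC L2normZ exprMn; congr (_ + _).
have : L2norm (w k) ^+ 2 = 1 by apply: complexI; rewrite -inner_self ow eqxx.
by move=> ->; rewrite mulr1.
Qed.

(** The partial expansion of [u] is orthogonal to the rest of [u]; keeping both
    terms of Pythagoras makes Bessel immediate. *)
Lemma bessel_defect w u (r : seq nat) : orthonormal_family w -> uniq r ->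
  L2norm u ^+ 2 = \sum_(i <- r) normc (inner u (w i)) ^+ 2
    + L2norm (u - \sum_(i <- r) inner u (w i) *: w i) ^+ 2.
Proof.
move=> ow ur; rewrite -(L2norm_orthonormal_sum (fun i => inner u (w i)) ow ur).
set p := \sum_(i <- r) _; rewrite -pythagoras ?[p + _]addrC ?subrK//.
rewrite /p inner_suml big_seq big1// => i ir; rewrite innerZl.
by rewrite [X in _ * X]inner_conj innerDl -scaleN1r innerZl
  (inner_orthonormal_sum (fun i => inner u (w i)))// ir mulN1r subrr rmorph0 mulr0.
Qed.

Lemma bessel w u (r : seq nat) : orthonormal_family w -> uniq r ->
  \sum_(i <- r) normc (inner u (w i)) ^+ 2 <= L2norm u ^+ 2.
Proof. by move=> ow ur; rewrite (bessel_defect u ow ur) lerDl sqr_ge0. Qed.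

End Hilbert.

(** * The norm of L_2(-pi, pi) *)

Section TriangleInequality.
Context (R : realType).
Implicit Types (u v : L2 R).

Lemma L2norm_sqrD u v :
  L2norm (u + v) ^+ 2 = L2norm u ^+ 2 + L2norm v ^+ 2 + 2 * complex.Re (inner u v).
Proof.
have : inner (u + v) (u + v) =
    inner u u + inner v v + (inner u v + (inner u v)^*%R).
  by rewrite -(inner_conj u v) innerDl !innerDr; ring.
rewrite !inner_self; case: (inner u v) => a b /(congr1 (@complex.Re R)) /= ->.
by ring.
Qed.

(** Expand the square of the norm of |v| u - |u| v, which is nonnegative. *)
Lemma Re_inner_le u v : complex.Re (inner u v) <= L2norm u * L2norm v.
Proof.
have [u0|u0] := eqVneq (L2norm u) 0.
  by rewrite u0 (L2norm_eq0 u0) inner0l mul0r.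
have [v0|v0] := eqVneq (L2norm v) 0.
  by rewrite v0 (L2norm_eq0 v0) inner_conj inner0l rmorph0 mulr0.
have p0 : 0 < L2norm u * L2norm v by rewrite mulr_gt0// lt0r ?u0 ?v0 L2norm_ge0.
(* The scaling avoids a division by the norms. *)
have h := sqr_ge0 (L2norm ((L2norm v)%:C *: u + (- (L2norm u)%:C) *: v)).
move: h; rewrite L2norm_sqrD !L2normZ innerZl innerZr normcN.
rewrite !normc_real ?L2norm_ge0//.
have -> : (- (L2norm u)%:C)^*%R = - (L2norm u)%:C :> R[i].
  by rewrite rmorphN /= conj_realC.
case: (inner u v) => a b /=; rewrite !(mul0r, mulr0, subr0, addr0, oppr0, add0r) => h.
have : 0 <= 2 * (L2norm u * L2norm v) * (L2norm u * L2norm v - a).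
  by apply: le_trans h _; rewrite le_eqVlt; apply/orP; left; apply/eqP; ring.
by rewrite pmulr_rge0 ?subr_ge0// mulr_gt0.
Qed.

Lemma L2normD u v : L2norm (u + v) <= L2norm u + L2norm v.
Proof.
rewrite -(@ler_pXn2r _ 2)// ?nnegrE ?addr_ge0 ?L2norm_ge0//.
by rewrite L2norm_sqrD; have := Re_inner_le u v; lra.
Qed.

Lemma L2normB_le u v : L2norm u - L2norm v <= L2norm (u + v).
Proof.
by rewrite lerBlDr -{1}[u](addrK v) -(L2normN v); exact: L2normD.
Qed.

End TriangleInequality.

(** * Bounds for singular values *)

Section SingularValues.
Context (R : realType).
Implicit Types (A B e : L2 R -> L2 R) (u v : L2 R).

Lemma linear_opE A : linear A ->
  [/\ A 0 = 0, forall u v, A (u + v) = A u + A v, forall c u, A (c *: u) = c *: A u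
    & forall (I : Type) (r : seq I) (F : I -> L2 R),
        A (\sum_(i <- r) F i) = \sum_(i <- r) A (F i)].
Proof.
move=> lA.
have A0 : A 0 = 0.
  have := lA (-1) 0 0; rewrite scaleN1r oppr0 addr0 => ->.
  by rewrite scaleN1r addNr.
have AD u v : A (u + v) = A u + A v by have := lA 1 u v; rewrite !scale1r.
split => // [c u|I r F]; first by have := lA c u 0; rewrite !addr0 A0 addr0.
exact: big_morph.
Qed.

Lemma opnorm_ge0 A : 0 <= opnorm A.
Proof.
rewrite /opnorm; set S := (X in sup X).
have [hs|/sup_out->//] := pselect (has_sup S).
by have [[x Sx] _] := hs; have [u _ ux] := Sx; rewrite (le_trans _ (sup_upper_bound hs Sx))//
   -ux L2norm_ge0.
Qed.

Lemma opnorm_le A M : 0 <= M -> (forall u, L2norm (A u) <= M * L2norm u) ->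
  opnorm A <= M.
Proof.
move=> M0 AM; apply: ge_sup.
  by exists (L2norm (A 0)), 0 => //=; rewrite L2norm0 ler01.
move=> _ [u /= u1 <-]; apply: le_trans (AM u) _.
by rewrite -[leRHS]mulr1 ler_wpM2l.
Qed.

Lemma opnormP A : bounded_op A -> forall u, L2norm (A u) <= opnorm A * L2norm u.
Proof.
move=> [lA [M AM]] u; have [A0 _ AZ _] := linear_opE lA.
have [u0|u0] := eqVneq (L2norm u) 0.
  by rewrite u0 (L2norm_eq0 u0) A0 L2norm0 mulr0.
have up : 0 < L2norm u by rewrite lt0r u0 L2norm_ge0.
rewrite -ler_pdivrMr// mulrC.
have nR : normc ((L2norm u)^-1%:C) = (L2norm u)^-1.
  by rewrite normc_real// invr_ge0 ltW.
have := L2normZ ((L2norm u)^-1%:C) (A u); rewrite nR => <-; rewrite -AZ.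
apply: ub_le_sup.
- exists (Num.max M 0) => _ [v /= v1 <-].
  apply: le_trans (AM v) _.
  rewrite (@le_trans _ _ (Num.max M 0 * L2norm v))//.
    by rewrite ler_wpM2r ?L2norm_ge0// le_max lexx.
  by rewrite -[leRHS]mulr1 ler_wpM2l// le_max lexx orbT.
- by exists ((L2norm u)^-1%:C *: u) => //=; rewrite L2normZ nR mulVf.
Qed.

(** The vectors [u - e u] and [e u] are orthogonal, since [e] is symmetric and
    idempotent. *)
Lemma orth_proj_compl_le e u : orth_proj e -> L2norm (u - e u) <= L2norm u.
Proof.
move=> [le ee es]; have [e0 eD eZ _] := linear_opE le.
rewrite -(@ler_pXn2r _ 2)// ?nnegrE ?L2norm_ge0//.
have h : inner (u - e u) (e u) = 0.
  by rewrite -es eD -scaleN1r eZ ee scaleN1r subrr inner0l.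
by have := pythagoras h; rewrite subrK => ->; rewrite lerDl sqr_ge0.
Qed.

Lemma bounded_comp_compl A e : bounded_op A -> orth_proj e ->
  bounded_op (fun u => A (u - e u)).
Proof.
move=> bA pe; have [lA [M _]] := bA; have [le ee es] := pe; split.
  move=> c u v; rewrite -lA; congr A.
  by rewrite le scalerBr opprD addrACA.
exists (opnorm A) => u; apply: le_trans (opnormP bA _) _.
by rewrite ler_wpM2l ?opnorm_ge0// orth_proj_compl_le.
Qed.

Lemma singular_value_le A e n : orth_proj e -> rank_le n e ->
  singular_value A n <= opnorm (fun u => A (u - e u)).
Proof.
move=> pe re; apply: ge_inf; last by exists e.
by exists 0 => _ [f _ <-]; exact: opnorm_ge0.
Qed.

Lemma orth_proj0 : orth_proj (fun _ : L2 R => 0 : L2 R).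
Proof.
split=> // [c u v|u v]; first by rewrite scaler0 addr0.
by rewrite inner0l inner_conj inner0l rmorph0.
Qed.

(** Let [e] be a projection of rank at most [n]. The images under [e] of the
    [n + 1] vectors [w i] have a nontrivial linear relation, so [e] kills a
    nonzero vector [z] of their span; on [z] the operators [A] and [A (1 - e)]
    agree, and the latter has norm at least [d]. *)
Lemma singular_value_ge A (w : nat -> L2 R) n d :
  bounded_op A -> orthonormal_family w ->
  (forall a : nat -> R[i], let v := \sum_(0 <= i < n.+1) a i *: w i in
     d * L2norm v <= L2norm (A v)) ->
  d <= singular_value A n.
Proof.
move=> bA ow Ad; apply: lb_le_inf.
  eexists; exists (fun=> 0); last reflexivity.
  split; first exact: orth_proj0.
  exists (fun=> 0) => u; exists (fun=> 0).
  by rewrite big1// => i _; rewrite scaler0.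
move=> _ [e [pe [v ev]] <-].
pose c i := sval (cid (ev (w i))).
have ec i : e (w i) = \sum_j c i j *: v j by exact: svalP (cid (ev (w i))).
pose C := \matrix_(i < n.+1, j < n) c i j.
have kC : kermx C != 0.
  by rewrite -mxrank_eq0 mxrank_ker subn_eq0 -ltnNge ltnS rank_leq_col.
(* [x] holds the coefficients of a linear relation between the vectors [e (w i)]. *)
pose x := nz_row (kermx C).
have x0 : x != 0 by rewrite nz_row_eq0.
have xC : x *m C = 0 by apply/sub_kermxP; exact: nz_row_sub.
pose a k := x 0 (inord k).
pose z := \sum_(0 <= i < n.+1) a i *: w i.
have z0 : 0 < L2norm z.
  rewrite lt0r L2norm_ge0 andbT -sqrf_eq0 L2norm_orthonormal_sum ?iota_uniq//.
  apply: contraNneq x0 => /eqP; rewrite psumr_eq0; last by move=> *; rewrite sqr_ge0.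
  move=> /allP h; apply/eqP/rowP => i; rewrite mxE.
  have /h : (i : nat) \in index_iota 0 n.+1 by rewrite mem_index_iota ltn_ord.
  by rewrite /= sqrf_eq0 => /eqP/eq0_normc; rewrite /a inord_val.
have ez : e z = 0.
  have [le _ _] := pe; have [_ _ eZ eS] := linear_opE le.
  rewrite /z eS big_mkord.
  under eq_bigr do rewrite eZ ec scaler_sumr.
  rewrite exchange_big big1//= => j _.
  under eq_bigr do rewrite scalerA.
  rewrite -scaler_suml (_ : \sum_i _ = (x *m C) 0 j); first by rewrite xC mxE scale0r.
  by rewrite mxE; apply: eq_bigr => i _; rewrite mxE /a inord_val.
have := opnormP (bounded_comp_compl bA pe) z; rewrite ez subr0.
by move=> /(le_trans (Ad a)); rewrite -/z ler_pM2r.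
Qed.

End SingularValues.

(** * Almost everywhere convergence *)

Section Completeness.

(** By monotone convergence the series of the absolute differences has a finite
    integral, hence a finite sum almost everywhere. *)
Lemma ae_cvgn_of_summable d (T : measurableType d) (R : realType)
    (m : {measure set T -> \bar R}) (g : nat -> T -> R) :
  (forall j, measurable_fun setT (g j)) ->
  (\sum_(0 <= j <oo) \int[m]_t `|(g j.+1 t - g j t)%:E| < +oo)%E ->
  {ae m, forall t, cvgn (g^~ t)}.
Proof.
move=> mg gs.
have md j : measurable_fun setT (fun t => `|(g j.+1 t - g j t)%:E|%E).
  apply: measurableT_comp => //; apply/measurable_EFinP.
  exact: measurable_funB.
pose H t := (\sum_(0 <= j <oo) `|(g j.+1 t - g j t)%:E|)%E.
have mH : measurable_fun setT H by apply: ge0_emeasurable_sum.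
have H0 t : (0 <= H t)%E by exact: nneseries_ge0.
have iH : m.-integrable setT H.
  apply/integrableP; split=> //.
  by under eq_integral do rewrite gee0_abs//; rewrite integral_nneseries.
apply: (@filterS _ _ (ae_filter_ringOfSetsType m)) (integrable_ae measurableT iH).
move=> t /= /(_ I) Hfin.
have -> : g^~ t = (fun n => g 0 t + series (telescope (g^~ t)) n).
  by apply/funext => n; exact: (eq_sum_telescope (g^~ t)).
apply: is_cvgD; first exact: is_cvg_cst.
apply: normed_cvg.
apply: nondecreasing_is_cvgn.
  by apply: nondecreasing_series => n _ _; exact: normr_ge0.
exists (fine (H t)) => _ [n _ <-].
rewrite -lee_fin fineK// /series /= -sumEFin.
exact: nneseries_lim_ge.
Qed.

(** Setting the functions to 0 on a measurable null set makes them converge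
    everywhere, which yields a limit that is measurable and not merely defined
    almost everywhere. *)
Lemma ae_cvg_measurable d (T : measurableType d) (R : realType)
    (m : {measure set T -> \bar R}) (g : nat -> T -> R) :
  (forall j, measurable_fun setT (g j)) -> {ae m, forall t, cvgn (g^~ t)} ->
  exists2 G : T -> R, measurable_fun setT G &
    {ae m, forall t, g^~ t @ \oo --> G t}.
Proof.
move=> mg [N [mN N0 gN]].
(* [h] agrees with [g] off the null set [N] and converges everywhere. *)
pose h j t := \1_(~` N) t * g j t.
pose G t := limn (h^~ t).
have hG t : h^~ t @ \oo --> G t.
  have [Nt|Nt] := pselect (N t).
    suff : cvgn (h^~ t) by [].
    rewrite (_ : h^~ t = fun=> 0); first exact: is_cvg_cst.
    by apply/funext => j; rewrite /h indicE memNset ?mul0r.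
  have gt : cvgn (g^~ t) by apply: contrapT => /gN.
  suff : cvgn (h^~ t) by [].
  rewrite (_ : h^~ t = g^~ t)//.
  by apply/funext => j; rewrite /h indicE mem_set ?mul1r.
exists G.
  apply: (@measurable_fun_cvg _ _ _ _ h) => // j.
  by apply: measurable_funM => //; apply: measurable_indic; exact: measurableC.
exists N; split => // t /= ngt; apply: contrapT => Nt; apply: ngt.
rewrite (_ : g^~ t = h^~ t)//.
by apply/funext => j; rewrite /h indicE mem_set ?mul1r.
Qed.

Lemma limn_einf_le (R : realType) (u : (\bar R)^nat) (b : \bar R) :
  (forall n, (u n <= b)%E) -> (limn_einf u <= b)%E.
Proof.
move=> ub; rewrite limn_einf_lim; apply: lime_le; first exact: is_cvg_einfs.
apply: nearW => n; apply: le_trans (ub n).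
by apply: ereal_inf_lbound; exists n => /=.
Qed.

Lemma Lfun2_of_sqr d (T : measurableType d) (R : realType)
    (m : {measure set T -> \bar R}) (h : T -> R) :
  measurable_fun setT h -> (\int[m]_t (h t ^+ 2)%:E < +oo)%E ->
  h \in Lfun m 2%:E.
Proof.
move=> mh hi; apply/andP; split; first by rewrite inE.
rewrite inE /= /finite_norm unlock /=; apply: poweR_lty.
apply: le_lt_trans hi; rewrite le_eqVlt; apply/orP; left; apply/eqP; apply: eq_integral => t _.
by rewrite /= powR_mulrn// real_normK// num_real.
Qed.

Context (R : realType).
Local Notation mu := (@leb_pi R).

Lemma L2pred_of_normc (f : R -> R[i]) : cmeasurable f ->
  (\int[mu]_t (normc (f t) ^+ 2)%:E < +oo)%E -> f \in @L2pred R.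
Proof.
move=> mf fi; have [m1 m2] := mf.
have mn : measurable_fun [set: measurableTypeR R] (fun t => (normc (f t) ^+ 2)%:E).
  by apply/measurable_EFinP; exact: measurable_normc_sqr.
have m1' : measurable_fun [set: measurableTypeR R] (fun t => (complex.Re (f t) ^+ 2)%:E).
  by apply/measurable_EFinP; exact: measurable_funX.
have m2' : measurable_fun [set: measurableTypeR R] (fun t => (complex.Im (f t) ^+ 2)%:E).
  by apply/measurable_EFinP; exact: measurable_funX.
apply/asboolP; split; apply: Lfun2_of_sqr => //; apply: le_lt_trans fi;
  apply: ge0_le_integral => // t _; rewrite lee_fin ?sqr_ge0// normc_sqr.
- by rewrite lerDl sqr_ge0.
- by rewrite lerDr sqr_ge0.
Qed.

(** Fatou for the squares of the moduli; it controls the limit in L_2 of a sequence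
    which converges only pointwise. *)
Lemma fatou_normc (w : nat -> R -> R[i]) (f : R -> R[i]) (B : \bar R) :
  (forall j, cmeasurable (w j)) -> cmeasurable f ->
  {ae mu, forall t, (fun j => complex.Re (w j t)) @ \oo --> complex.Re (f t)} ->
  {ae mu, forall t, (fun j => complex.Im (w j t)) @ \oo --> complex.Im (f t)} ->
  (forall j, (\int[mu]_t (normc (w j t) ^+ 2)%:E <= B)%E) ->
  (\int[mu]_t (normc (f t) ^+ 2)%:E <= B)%E.
Proof.
move=> mw mf wr wi wB.
have mn g : cmeasurable g ->
    measurable_fun [set: measurableTypeR R] (fun t => (normc (g t) ^+ 2)%:E).
  by move=> mg; apply/measurable_EFinP; exact: measurable_normc_sqr.
rewrite (@ge0_ae_eq_integral _ _ _ mu setT _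
    (fun t => limn_einf (fun j => (normc (w j t) ^+ 2)%:E)))//; first last.
- apply: aeS2 wr wi => t wr wi _; apply/esym.
  suff /cvg_limn_einf_sup[-> _] : (fun j => (normc (w j t) ^+ 2)%:E) @ \oo -->
    (normc (f t) ^+ 2)%:E by [].
  apply: cvg_EFin; first exact: nearW.
  rewrite normc_sqr (_ : _ \o _ = (fun j => complex.Re (w j t) ^+ 2 +
    complex.Im (w j t) ^+ 2)); last by apply/funext => j /=; rewrite normc_sqr.
  by apply: cvgD; apply: cvgM.
- move=> t _; rewrite limn_einf_lim; apply: lime_ge; first exact: is_cvg_einfs.
  by apply: nearW => n; apply: le_ereal_inf_tmp => _ [k _ <-]; rewrite lee_fin sqr_ge0.
- by move=> t _; rewrite lee_fin sqr_ge0.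
- rewrite (_ : (fun _ => _) = (fun t => - limn_esup (fun j => - (normc (w j t) ^+ 2)%:E))%E).
    apply: measurableT_comp => //; apply: measurable_fun_limn_esup => j.
    by apply: measurableT_comp => //; exact: mn.
  by apply/funext => t; rewrite -limn_einfN; congr limn_einf; apply/funext => j /=; rewrite opprK.
- exact: mn.
apply: le_trans (fatou mu measurableT _ _) _ => //.
- by move=> n; exact: mn.
- by move=> n t _; rewrite lee_fin sqr_ge0.
- exact: limn_einf_le.
Qed.

End Completeness.

(** * Completeness of L_2(-pi, pi) *)

Section L2Complete.
Context (R : realType).
Local Notation mu := (@leb_pi R).
Implicit Types (u v : L2 R).

Lemma L2fctB u v :
  {ae mu, forall t, L2fct (u - v) t = L2fct u t - L2fct v t}.
Proof.
apply: aeS2 (L2fctD u (- v)) (L2fctZ (-1) v) => t ->.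
by rewrite scaleN1r mulN1r => ->.
Qed.

(** Integrate |h| <= |v| <= p + |v|^2 / p. With p chosen as the rate of convergence this
    turns a bound of the differences in L_2 into a summable bound in L_1. *)
Lemma integral_abs_le_weighted_sqr (h : R -> R) v (p : R) : 0 < p ->
  measurable_fun [set: measurableTypeR R] h ->
  {ae mu, forall t, `|h t| <= normc (L2fct v t)} ->
  (\int[mu]_t `|(h t)%:E| <= p%:E * mu setT + (p^-1 * L2norm v ^+ 2)%:E)%E.
Proof.
move=> p0 mh hv.
have mn : measurable_fun [set: measurableTypeR R] (fun t => (normc (L2fct v t) ^+ 2)%:E).
  by apply/measurable_EFinP; apply: measurable_normc_sqr; exact: L2fct_cmeas.
rewrite EFinM L2norm_integral -integral_cst// -ge0_integralZl_EFin//; first last.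
- by rewrite invr_ge0 ltW.
- by move=> t _; rewrite lee_fin sqr_ge0.
have mZ : measurable_fun [set: measurableTypeR R]
    (fun t => p^-1%:E * (normc (L2fct v t) ^+ 2)%:E)%E.
  exact: measurable_funeM.
rewrite -ge0_integralD//; first last.
- by move=> t _; rewrite mule_ge0// lee_fin ?sqr_ge0// invr_ge0 ltW.
- by move=> t _; rewrite lee_fin ltW.
apply: ae_ge0_le_integral => //.
- by apply: measurableT_comp => //; exact/measurable_EFinP.
- by move=> t _; rewrite adde_ge0 ?mule_ge0// lee_fin ?sqr_ge0// ?invr_ge0 ltW.
- exact: emeasurable_funD.
apply: aeS hv => t ht _; rewrite -EFinM -EFinD lee_fin.
apply: le_trans ht _; set n := normc _.
have h1 := sqr_ge0 (n - p); have n0 : 0 <= n := normc_ge0 _.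
rewrite -(ler_pM2l p0) mulrDr mulrA divff ?gt_eqF// mul1r.
nra.
Qed.

Lemma vanishing_subseq (b : nat -> R) : b @ \oo --> 0 ->
  exists k : nat -> nat, [/\ forall j, (j <= k j)%N,
    forall i j, (i <= j)%N -> (k i <= k j)%N
    & forall j, b (k j) <= 2^-1 ^+ j].
Proof.
move=> b0.
have h j : exists N, forall n, (N <= n)%N -> b n <= 2^-1 ^+ j.
  have e0 : (0 : R) < 2^-1 ^+ j by rewrite exprn_gt0// invr_gt0.
  have /cvgrPdist_le/(_ _ e0)[N _ NP] := b0.
  exists N => n Nn; have := NP n Nn; rewrite /= sub0r normrN.
  by apply: le_trans; exact: ler_norm.
have [K KP] := choice h.
(* Summing the thresholds gives a monotone choice; the successors make it unbounded. *)
pose k j := (\sum_(0 <= i < j.+1) (K i).+1)%N; exists k; split.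
- elim=> // j IH; rewrite /k big_nat_recr//=.
  by rewrite addnS ltnS (leq_trans IH)// leq_addr.
- move=> i j ij; rewrite /k [leqRHS](big_cat_nat (n := i.+1))//=.
  exact: leq_addr.
- by move=> j; apply: KP; rewrite /k big_nat_recr//= addnS leqW// leq_addl.
Qed.

(** The Riesz-Fischer theorem, with its rate: along a subsequence for which
    [b] is below 2^-j the real and imaginary parts converge almost everywhere,
    and Fatou transfers the estimate for [w (k j) - w n] to the limit. *)
Lemma L2_complete (w : nat -> L2 R) (b : nat -> R) : b @ \oo --> 0 ->
  (forall m n, (m <= n)%N -> L2norm (w n - w m) <= b m) ->
  exists v, forall n, L2norm (v - w n) <= b n.
Proof.
move=> b0 wb.
have [k [kj kmono kb]] := vanishing_subseq b0.
have mw j : cmeasurable (L2fct (w j)) by exact: L2fct_cmeas.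
have bnn n : 0 <= b n by have := wb n n (leqnn _); rewrite subrr L2norm0.
have conv (proj : R[i] -> R) : (forall x y, proj (x - y) = proj x - proj y) ->
    (forall x, `|proj x| <= normc x) ->
    (forall j, measurable_fun [set: measurableTypeR R] (fun t => proj (L2fct (w j) t))) ->
    exists2 G : R -> R, measurable_fun [set: measurableTypeR R] G &
      {ae mu, forall t, (fun j => proj (L2fct (w (k j)) t)) @ \oo --> G t}.
  move=> projB projn mproj.
  apply: (@ae_cvg_measurable _ _ _ mu (fun j t => proj (L2fct (w (k j)) t))).
    by move=> j; exact: mproj.
  apply: (@ae_cvgn_of_summable _ _ _ mu (fun j t => proj (L2fct (w (k j)) t))).
    by move=> j; exact: mproj.
  have [M M0 muM] : exists2 M : R, 0 <= M & mu setT = M%:E.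
    exists (fine (mu setT)); first exact: fine_ge0.
    by rewrite fineK// fin_num_measure.
  have step j : (\int[mu]_t `|(proj (L2fct (w (k j.+1)) t) - proj (L2fct (w (k j)) t))%:E|
      <= ((2 * (M + 1)) / (2 ^ (j + 1))%:R)%:E)%E.
    have p0 : (0 : R) < 2^-1 ^+ j by rewrite exprn_gt0// invr_gt0.
    apply: le_trans (@integral_abs_le_weighted_sqr _ (w (k j.+1) - w (k j)) _ p0 _ _) _.
    - exact: measurable_funB.
    - by apply: aeS (L2fctB (w (k j.+1)) (w (k j))) => t ->; rewrite -projB.
    - rewrite muM -EFinM -EFinD lee_fin.
      have : L2norm (w (k j.+1) - w (k j)) ^+ 2 <= (2^-1 ^+ j) ^+ 2.
        rewrite ler_pXn2r// ?nnegrE ?L2norm_ge0 ?(ltW p0)//.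
        by apply: le_trans (kb j); apply: wb; exact: kmono.
      move=> h; apply: le_trans (lerD (lexx _) (ler_wpM2l _ h)) _.
        by rewrite invr_ge0 ltW.
      have -> : 2 * (M + 1) / (2 ^ (j + 1))%:R = (M + 1) * 2^-1 ^+ j :> R.
        rewrite addn1 natrX exprS invfM exprVn mulrACA divff// mul1r.
        by [].
      by rewrite expr2 mulrA mulVf ?gt_eqF// mul1r mulrDl mul1r mulrC.
  apply: le_lt_trans (lee_nneseries _ (fun j _ => step j)) _.
    by move=> j _ _; exact: integral_ge0.
  have /cvg_lim -> // := @cvg_geometric_eseries_half _ (2 * (M + 1)) 0.
  by rewrite ltry.
have [G mG Gr] : exists2 G : R -> R, measurable_fun [set: measurableTypeR R] G &
      {ae mu, forall t, (fun j => complex.Re (L2fct (w (k j)) t)) @ \oo --> G t}.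
  apply: conv; first by case=> ? ? [].
    move=> [x y] /=; rewrite -sqrtr_sqr ler_sqrt ?lerDl ?sqr_ge0//.
    by rewrite addr_ge0 ?sqr_ge0.
  by move=> j; have [] := mw j.
have [H mH Hr] : exists2 G : R -> R, measurable_fun [set: measurableTypeR R] G &
      {ae mu, forall t, (fun j => complex.Im (L2fct (w (k j)) t)) @ \oo --> G t}.
  apply: conv; first by case=> ? ? [].
    move=> [x y] /=; rewrite -sqrtr_sqr ler_sqrt ?lerDr ?sqr_ge0//.
    by rewrite addr_ge0 ?sqr_ge0.
  by move=> j; have [] := mw j.
pose f t := G t +i* H t.
have mf : cmeasurable f by split.
have mfB n : cmeasurable (f - L2fct (w n)).
  have [m1 m2] := mw n; split.
    rewrite (_ : (fun _ => _) = (fun t => G t - complex.Re (L2fct (w n) t))).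
      exact: measurable_funB.
    by apply/funext => t; rewrite !fctE; case: (L2fct (w n) t).
  rewrite (_ : (fun _ => _) = (fun t => H t - complex.Im (L2fct (w n) t))).
    exact: measurable_funB.
  by apply/funext => t; rewrite !fctE; case: (L2fct (w n) t).
have lim_proj n (proj : R[i] -> R) : (forall x y, proj (x - y) = proj x - proj y) ->
    {ae mu, forall t, (fun j => proj (L2fct (w (k j)) t)) @ \oo --> proj (f t)} ->
    {ae mu, forall t, (fun j => proj (L2fct (w (k (j + n)%N) - w n) t)) @ \oo
       --> proj ((f - L2fct (w n)) t)}.
  move=> projB hf.
  have : {ae mu, forall t, forall j,
      L2fct (w (k (j + n)%N) - w n) t = L2fct (w (k (j + n)%N)) t - L2fct (w n) t}.
    by apply/ae_foralln => j; exact: L2fctB.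
  apply: aeS2 hf => t ht he; rewrite !fctE projB.
  rewrite (_ : (fun j => _) = (fun j => proj (L2fct (w (k (j + n)%N)) t) -
      proj (L2fct (w n) t))); last by apply/funext => j; rewrite he projB.
  apply: cvgB; last exact: cvg_cst.
  by rewrite (cvg_shiftn n (fun j => proj (L2fct (w (k j)) t))).
have fn n : (\int[mu]_t (normc ((f - L2fct (w n)) t) ^+ 2)%:E <= (b n ^+ 2)%:E)%E.
  (* The shift by [n] gives indices [k (j + n) >= n], so that the hypothesis applies. *)
  apply: (@fatou_normc _ (fun j => L2fct (w (k (j + n)%N) - w n)) (f - L2fct (w n))) => //.
  - by move=> j; exact: L2fct_cmeas.
  - apply: lim_proj Gr => // [[x y] [z t]]//.
  - apply: lim_proj Hr => // [[x y] [z t]]//.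
  - move=> j; rewrite -L2norm_integral lee_fin ler_pXn2r// ?nnegrE ?L2norm_ge0//.
    by apply: wb; apply: leq_trans (kj _); exact: leq_addl.
have wnf n : L2fct (w n) \in @L2pred R by exact: L2fctP.
have fL2 : f \in @L2pred R.
  rewrite (_ : f = (f - L2fct (w 0%N)) + L2fct (w 0%N)); last by rewrite subrK.
  apply: rpredD => //; apply: L2pred_of_normc; first exact: mfB.
  by apply: le_lt_trans (fn 0%N) _; rewrite ltry.
pose v : L2 R := \pi_(L2 R) (MkL2fun fL2); exists v => n.
rewrite -(@ler_pXn2r _ 2)// ?nnegrE ?L2norm_ge0// -lee_fin L2norm_integral.
apply: le_trans (fn n); rewrite le_eqVlt; apply/orP; left; apply/eqP.
apply: ge0_ae_eq_integral => //.
- apply/measurable_EFinP; apply: measurable_normc_sqr; exact: L2fct_cmeas.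
- apply/measurable_EFinP; apply: measurable_normc_sqr; exact: mfB.
- by move=> t _; rewrite lee_fin sqr_ge0.
- by move=> t _; rewrite lee_fin sqr_ge0.
- by apply: aeS2 (L2fctB v (w n)) (L2fct_pi (MkL2fun fL2)) => t -> ->.
Qed.

End L2Complete.

(** * Diagonal operators *)

Section DiagonalOperators.
Context (R : realType).
Implicit Types (w : nat -> L2 R) (s : nat -> R) (u v : L2 R) (A : L2 R -> L2 R).

Definition diag_sum w s N u : L2 R :=
  \sum_(0 <= i < N) ((s i)%:C * inner u (w i)) *: w i.

(** The estimate for all [N] states that the partial sums converge to [A] in norm at
    the rate [s]; for [s] tending to 0 it determines [A], and it hands over every
    bound that is needed below without a separate limit argument. *)
Definition diag_op w s A :=
  linear A /\ forall N u, L2norm (A u - diag_sum w s N u) <= s N * L2norm u.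

Definition decreasing_to0 s :=
  (forall m n, (m <= n)%N -> s n <= s m) /\ s @ \oo --> 0.

Lemma decreasing_to0_ge0 s n : decreasing_to0 s -> 0 <= s n.
Proof.
move=> [sm s0]; rewrite -(cvg_lim _ s0)//; apply: limr_le.
  by apply/cvg_ex; exists 0.
by near=> m; apply: sm; near: m; exact: nbhs_infty_ge.
Unshelve. all: by end_near. Qed.

Lemma diag_sum_linear w s N : linear (diag_sum w s N).
Proof.
move=> c u v; rewrite /diag_sum scaler_sumr -big_split /=; apply: eq_bigr => i _.
by rewrite scalerA -scalerDl innerDl innerZl; congr (_ *: _); ring.
Qed.

Lemma diag_sum_tail w s M N u : orthonormal_family w -> decreasing_to0 s ->
  (N <= M)%N -> L2norm (diag_sum w s M u - diag_sum w s N u) <= s N * L2norm u.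
Proof.
move=> ow ds NM.
rewrite /diag_sum (big_cat_nat (n := N))//= addrAC subrr add0r.
have sN := decreasing_to0_ge0 N ds.
rewrite -(@ler_pXn2r _ 2)// ?nnegrE ?mulr_ge0 ?L2norm_ge0//.
rewrite L2norm_orthonormal_sum ?iota_uniq// exprMn.
apply: le_trans (ler_wpM2l (sqr_ge0 _) (bessel u ow (iota_uniq N (M - N)))).
rewrite mulr_sumr big_seq [leRHS]big_seq; apply: ler_sum => i.
rewrite mem_index_iota => /andP[Ni iM].
have si := decreasing_to0_ge0 i ds.
rewrite normcM normc_real// exprMn ler_wpM2r ?sqr_ge0//.
by rewrite ler_pXn2r ?nnegrE//; exact: ds.1.
Qed.

Lemma L2norm_le_null (x c : R) s : s @ \oo --> 0 ->
  (forall n, x <= s n * c) -> x <= 0.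
Proof.
move=> s0 h; have : (fun n => s n * c) @ \oo --> 0.
  by rewrite -(mul0r c); apply: cvgM => //; exact: cvg_cst.
move=> sc; rewrite -(cvg_lim _ sc)//; apply: limr_ge; last exact: nearW.
by apply/cvg_ex; exists 0.
Qed.

(** The partial sums are uniformly Cauchy by [diag_sum_tail]; linearity of the
    limit follows from that of the partial sums. *)
Lemma diagonal_exists w s : orthonormal_family w -> decreasing_to0 s ->
  exists A, diag_op w s A.
Proof.
move=> ow ds.
have h u : exists v, forall N, L2norm (v - diag_sum w s N u) <= s N * L2norm u.
  apply: L2_complete => [|m n mn]; last exact: diag_sum_tail.
  by rewrite -(mul0r (L2norm u)); apply: cvgM; [exact: ds.2|exact: cvg_cst].
have [A AP] := choice h; exists A; split; last by move=> N u; exact: AP.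
move=> c u v; apply/eqP; rewrite -subr_eq0; apply/eqP/L2norm_eq0/le_anti.
rewrite L2norm_ge0 andbT.
apply: (@L2norm_le_null _ (L2norm (c *: u + v) + (normc c * L2norm u + L2norm v)) s ds.2).
move=> N.
have -> : A (c *: u + v) - (c *: A u + A v) =
    (A (c *: u + v) - diag_sum w s N (c *: u + v)) -
    (c *: (A u - diag_sum w s N u) + (A v - diag_sum w s N v)).
  by rewrite diag_sum_linear scalerBr addrACA -opprD opprB addrA subrK.
rewrite mulrDr; apply: le_trans (L2normD _ _) (lerD (AP _ _) _).
rewrite L2normN mulrDr; apply: le_trans (L2normD _ _) (lerD _ (AP _ _)).
by rewrite L2normZ mulrCA ler_wpM2l ?normc_ge0.
Qed.

Lemma diagonal_norm w s A u : diag_op w s A -> L2norm (A u) <= s 0%N * L2norm u.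
Proof. by move=> [_ /(_ 0%N u)]; rewrite /diag_sum big_geq// subr0. Qed.

Lemma diagonal_bounded w s A : diag_op w s A -> bounded_op A.
Proof.
by move=> dA; split; [exact: dA.1|exists (s 0%N) => u; exact: diagonal_norm dA].
Qed.

Lemma diag_sum_orthonormal w s (a : nat -> R[i]) n N : orthonormal_family w ->
  (n <= N)%N -> diag_sum w s N (\sum_(0 <= i < n) a i *: w i) =
    \sum_(0 <= i < n) ((s i)%:C * a i) *: w i.
Proof.
move=> ow nN; rewrite /diag_sum (big_cat_nat (n := n))//=.
rewrite [X in _ + X]big_nat [X in _ + X]big1 ?addr0.
  apply: eq_big_nat => i /andP[_ i_n].
  by rewrite inner_orthonormal_sum ?iota_uniq// mem_index_iota i_n.
move=> i /andP[ni _].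
by rewrite inner_orthonormal_sum ?iota_uniq// mem_index_iota ltnNge ni mulr0 scale0r.
Qed.

Lemma diagonal_apply w s A (a : nat -> R[i]) n : orthonormal_family w ->
  decreasing_to0 s -> diag_op w s A ->
  A (\sum_(0 <= i < n) a i *: w i) = \sum_(0 <= i < n) ((s i)%:C * a i) *: w i.
Proof.
move=> ow ds [_ dA]; set v := \sum_(0 <= i < n) _.
apply/eqP; rewrite -subr_eq0; apply/eqP/L2norm_eq0/le_anti; rewrite L2norm_ge0 andbT.
apply: (@L2norm_le_null _ (L2norm v) (fun k => s (k + n)%N)).
  by rewrite (cvg_shiftn n s); exact: ds.2.
by move=> k; have := dA (k + n)%N v; rewrite /v diag_sum_orthonormal// leq_addl.
Qed.

(** By orthonormality, the coordinates of [e u] are those of [u] below [n], and 0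
    from [n] on. *)
Lemma partial_proj w n : orthonormal_family w ->
  let e := diag_sum w (fun=> 1) n in
  [/\ orth_proj e, rank_le n e & forall u i, (i < n)%N -> inner (u - e u) (w i) = 0].
Proof.
move=> ow e.
have ei u i : inner (e u) (w i) = if (i < n)%N then inner u (w i) else 0.
  rewrite /e /diag_sum inner_orthonormal_sum ?iota_uniq// mem_index_iota /=.
  by rewrite mul1r.
split.
- split; first exact: diag_sum_linear.
    move=> u; rewrite {1}/e /diag_sum [RHS]/e /diag_sum.
    by apply: eq_big_nat => i /andP[_ i_n]; rewrite ei i_n.
  move=> u v; rewrite [RHS]inner_conj /e /diag_sum !inner_suml rmorph_sum /=.
  apply: eq_bigr => i _; rewrite !innerZl !mul1r [in RHS]rmorphM /=.
  by rewrite -(inner_conj v (w i)) -(inner_conj (w i) u) mulrC.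
- exists (fun i : 'I_n => w i) => u; exists (fun i => 1 * inner u (w i)).
  by rewrite /e /diag_sum big_mkord.
- by move=> u i i_n; rewrite innerDl -scaleN1r innerZl ei i_n mulN1r subrr.
Qed.

(** After removal of the first [n] coordinates, the [n]-th partial sum vanishes
    and only the error term [s n] is left. *)
Lemma singular_value_diagonal_le w s A n : orthonormal_family w ->
  decreasing_to0 s -> diag_op w s A -> singular_value A n <= s n.
Proof.
move=> ow ds [_ dA]; have [pe re e0] := partial_proj n ow.
apply: le_trans (singular_value_le A pe re) _.
apply: opnorm_le; first exact: decreasing_to0_ge0.
set e := diag_sum _ _ _ in pe re e0 *; move=> u.
have := dA n (u - e u); rewrite {1}/diag_sum big_nat big1 => [|i /andP[_ i_n]].
  rewrite subr0 => /le_trans; apply; rewrite ler_wpM2l ?(decreasing_to0_ge0 _ ds)//.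
  exact: orth_proj_compl_le.
by rewrite e0// mulr0 scale0r.
Qed.

Lemma singular_value_diagonal w s A n : orthonormal_family w ->
  decreasing_to0 s -> diag_op w s A -> singular_value A n = s n.
Proof.
move=> ow ds dA; apply/le_anti; rewrite (@singular_value_diagonal_le w)//=.
apply: (singular_value_ge (diagonal_bounded dA) ow) => a /=.
have sn := decreasing_to0_ge0 n ds.
rewrite (diagonal_apply _ _ ow ds dA).
rewrite -(@ler_pXn2r _ 2)// ?nnegrE ?mulr_ge0 ?L2norm_ge0//.
rewrite exprMn !L2norm_orthonormal_sum ?iota_uniq// mulr_sumr big_nat [leRHS]big_nat.
apply: ler_sum => i /andP[_ i_n].
have si := decreasing_to0_ge0 i ds.
rewrite normcM normc_real// exprMn ler_wpM2r ?sqr_ge0//.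
by rewrite ler_pXn2r ?nnegrE//; exact: ds.1.
Qed.

Definition truncate s N := fun i => if (i < N)%N then s i else 0.

Lemma truncate_decreasing s N : decreasing_to0 s -> decreasing_to0 (truncate s N).
Proof.
move=> ds; split.
  move=> m n mn; rewrite /truncate; case: ifP => [nN|_].
    by rewrite (leq_ltn_trans mn nN); exact: ds.1.
  by case: ifP => // _; exact: decreasing_to0_ge0.
rewrite -(cvg_shiftn N) (_ : (fun _ => _) = fun=> 0); first exact: cvg_cst.
by apply/funext => n; rewrite /truncate ltnNge leq_addl.
Qed.

(** Finite sections are diagonal operators too, with entries cut off at [N]. Hence the
    logarithmic norm of a section and of its remainder can be computed in the
    same way. *)
Lemma diagonal_truncate w s N : orthonormal_family w -> decreasing_to0 s ->
  diag_op w (truncate s N) (diag_sum w s N).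
Proof.
move=> ow ds; split; first exact: diag_sum_linear.
move=> M u.
have -> : diag_sum w (truncate s N) M u = diag_sum w s (minn M N) u.
  rewrite /diag_sum (big_cat_nat (n := minn M N) (p := M)) ?geq_minl//=.
  rewrite [X in _ + X]big_nat [X in _ + X]big1 ?addr0; last first.
    move=> i /andP[+ iM]; rewrite geq_min leqNgt iM /= => Ni.
    by rewrite /truncate ltnNge Ni mul0r scale0r.
  apply: eq_big_nat => i /andP[_].
  by rewrite /truncate leq_min => /andP[_ ->].
rewrite /truncate; case: (ltnP M N) => [MN|NM].
  by apply: diag_sum_tail => //; exact: ltnW.
by rewrite subrr L2norm0 mul0r.
Qed.

Lemma diagonal_remainder w s A N : diag_op w s A ->
  diag_op (fun i => w (i + N)%N) (fun i => s (i + N)%N)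
    (A - diag_sum w s N).
Proof.
move=> [lA dA]; split.
  move=> c u v; rewrite !fctE lA diag_sum_linear scalerBr opprD addrACA.
  by congr (_ + _).
move=> M u; have := dA (M + N)%N u; rewrite !fctE; congr (L2norm _ <= _).
rewrite -addrA -opprD; congr (_ - _).
rewrite /diag_sum (big_cat_nat (n := N)) ?leq_addl//=; congr (_ + _).
by rewrite -{1}[N]add0n big_addn addnK.
Qed.

End DiagonalOperators.

(** * Signed integrals of functions with a primitive *)

Section PrimitiveIntegrals.
Context (R : realType).
Local Notation mu := (@leb_pi R).
Local Notation leb := (@lebesgue_measure R).
Implicit Types f F : R -> R.

Lemma integral_oo_primitive f F (a b : R) : a < b -> continuous f ->
  (forall x : R, is_derive x 1 F (f x)) ->
  (\int[leb]_(x in `]a, b[) (f x)%:E = (F b - F a)%:E)%E.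
Proof.
move=> ab cf dF.
have mf : measurable_fun `]a, b[ (EFin \o f).
  apply/measurable_EFinP; apply: measurable_funTS.
  exact: continuous_measurable_fun.
rewrite -(integral_itv_bndoo true false mf).
have cF : continuous F.
  move=> x; apply: differentiable_continuous.
  by apply/derivable1_diffP; have [] := dF x.
rewrite (@continuous_FTC2 _ f F)//.
- exact: continuous_subspaceT.
- split.
  + by move=> x _; exact: (@ex_derive _ _ _ _ _ _ _ (dF x)).
  + exact: (cvg_at_right_filter (cF a)).
  + exact: (cvg_at_left_filter (cF b)).
- by move=> x _; rewrite derive1E; exact: (@derive_val _ _ _ _ _ _ _ (dF x)).
Qed.

Lemma leb_pi_sub (A : set (measurableTypeR R)) (h : R -> \bar R) :
  A `<=` @Ipi R -> (\int[mu]_(x in A) h x = \int[leb]_(x in A) h x)%E.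
Proof.
move=> AI; apply: eq_measure_integral => B mB BA.
rewrite /leb_pi /mfrestr /mrestr /=; congr leb.
by apply/setIidPl; apply: subset_trans BA AI.
Qed.

Lemma leb_pi_integral (h : R -> \bar R) :
  measurable_fun [set: measurableTypeR R] h ->
  (\int[mu]_x h x = \int[mu]_(x in @Ipi R) h x)%E.
Proof.
move=> mh; rewrite -(setvU (@Ipi R)) integral_setU//; first last.
- by apply/disj_setPS; rewrite setICl.
- by rewrite setvU.
- exact: measurable_Ipi.
- by apply: measurableC; exact: measurable_Ipi.
rewrite (eq_measure_integral mzero) ?integral_measure_zero ?add0e//.
move=> B mB BI; change (leb (B `&` @Ipi R) = 0%E).
have -> : B `&` @Ipi R = set0 by apply/disjoints_subset.
by rewrite measure0.
Qed.

Lemma pi_gtN : - pi < pi :> R.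
Proof. by have := pi_gt0 R; lra. Qed.

Lemma integral_primitive f F : continuous f ->
  (forall x : R, is_derive x 1 F (f x)) -> \int[mu]_x f x = F pi - F (- pi).
Proof.
move=> cf dF; rewrite /Rintegral leb_pi_integral; last first.
  by apply/measurable_EFinP; exact: continuous_measurable_fun.
rewrite leb_pi_sub// (@integral_oo_primitive f F)//.
exact: pi_gtN.
Qed.

Lemma measurable_sgr : measurable_fun [set: R] (@Num.sg R).
Proof.
rewrite (_ : Num.sg = fun x : R =>
    \1_(`]0, +oo[%classic : set R) x - \1_(`]-oo, 0[%classic : set R) x).
  by apply: measurable_funB; apply: measurable_indic; exact: measurable_itv.
apply/funext => x; rewrite !indicE.
case: (ltgtP x 0) => x0.
- rewrite ltr0_sg// memNset ?mem_set//= ?in_itv/= ?sub0r// => x0'.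
  by move: x0'; rewrite andbT ltNge (ltW x0).
- rewrite gtr0_sg// [in X in _ - X]memNset ?mem_set//= ?in_itv/= ?x0 ?subr0// => x0'.
  by move: x0'; rewrite ltNge (ltW x0).
- by rewrite x0 sgr0 !memNset//= ?in_itv/= ?ltxx ?subrr.
Qed.

Lemma measurable_sg_sub (t : R) f : measurable_fun [set: R] f ->
  measurable_fun [set: R] (fun s => Num.sg (t - s) * f s).
Proof.
move=> mf; apply: measurable_funM => //.
apply: (measurableT_comp measurable_sgr).
exact: measurable_funB.
Qed.

(** Split the interval at [t], where the sign changes. *)
Lemma integral_sg_primitive f F (t : R) : - pi < t < pi -> continuous f ->
  (forall x : R, is_derive x 1 F (f x)) ->
  \int[mu]_s (Num.sg (t - s) * f s) = 2 * F t - F pi - F (- pi).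
Proof.
move=> /andP[Nt tp] cf dF.
have mf : measurable_fun [set: R] f by exact: continuous_measurable_fun.
pose h s := (Num.sg (t - s) * f s)%:E.
have mh : measurable_fun [set: measurableTypeR R] h.
  by apply/measurable_EFinP; exact: measurable_sg_sub.
change (fine (\int[mu]_x h x)%E = 2 * F t - F pi - F (- pi)).
rewrite leb_pi_integral// leb_pi_sub//.
have -> : @Ipi R = (`]- pi, t[%classic `|` `[t, pi[%classic)%R.
  by rewrite /Ipi (@itv_bndbnd_setU _ _ _ (BLeft t))// bnd_simp ltW.
rewrite integral_setU//; first last.
- apply/disj_setPS => x [/=]; rewrite !in_itv /= => /andP[_ xt] /andP[tx _].
  by move: xt; rewrite ltNge tx.
- exact: measurable_funTS.
(* The sign vanishes at [t] itself; remove this null set. *)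
rewrite (@integral_itv_bndoo _ t pi h true true); last exact: measurable_funTS.
rewrite (_ : (\int[leb]_(x in [set` `]- pi, t[%R]) h x)%E =
    (\int[leb]_(x in [set` `]- pi, t[%R]) (f x)%:E)%E); last first.
  apply: eq_integral => s; rewrite inE /= in_itv /= => /andP[_ st].
  by rewrite /h gtr0_sg ?mul1r// subr_gt0.
rewrite (_ : (\int[leb]_(x in [set` `]t, pi[%R]) h x)%E =
    (\int[leb]_(x in [set` `]t, pi[%R]) (- f x)%:E)%E); last first.
  apply: eq_integral => s; rewrite inE /= in_itv /= => /andP[st _].
  by rewrite /h ltr0_sg ?mulN1r// subr_lt0.
rewrite (@integral_oo_primitive f F)//.
rewrite (@integral_oo_primitive (fun x => - f x) (fun x => - F x))//.
  by rewrite /=; ring.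
by move=> x; apply: continuousN; exact: cf.
Qed.

End PrimitiveIntegrals.

(** * Exponentials of integer and half-integer frequency *)

Section Exponentials.
Context (R : realType).
Local Notation mu := (@leb_pi R).
Implicit Types (a b w t : R).

Definition cexp a t : R[i] := cos (a * t) +i* sin (a * t).

Lemma cexpD a b t : cexp (a + b) t = cexp a t * cexp b t.
Proof.
apply/eqP; rewrite eq_complex /= mulrDl cosD sinD.
by apply/andP; split; apply/eqP; ring.
Qed.

Lemma cexpN a t : cexp (- a) t = (cexp a t)^*%R.
Proof. by apply/eqP; rewrite eq_complex /= mulNr cosN sinN !eqxx. Qed.

Lemma cexp_sub a t s : cexp a (t - s) = cexp a t * cexp (- a) s.
Proof.
rewrite cexpN; apply/eqP; rewrite eq_complex /= mulrBr cosB sinB.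
by apply/andP; split; apply/eqP; ring.
Qed.

Lemma cexp0 t : cexp 0 t = 1.
Proof. by apply/eqP; rewrite eq_complex /= mul0r cos0 sin0 !eqxx. Qed.

Lemma continuous_mull a : continuous (fun t : R => a * t).
Proof. by move=> x; apply: cvgM; [exact: cvg_cst|exact: cvg_id]. Qed.

Lemma continuous_cosM a : continuous (fun t : R => cos (a * t)).
Proof.
move=> x; apply: (@continuous_comp _ _ _ ( *%R a) (@cos R)).
  exact: continuous_mull.
exact: continuous_cos.
Qed.

Lemma continuous_sinM a : continuous (fun t : R => sin (a * t)).
Proof.
move=> x; apply: (@continuous_comp _ _ _ ( *%R a) (@sin R)).
  exact: continuous_mull.
exact: continuous_sin.
Qed.

Lemma cexp_cmeasurable a : cmeasurable (cexp a).
Proof.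
by split; apply: continuous_measurable_fun;
  [exact: continuous_cosM|exact: continuous_sinM].
Qed.

Lemma Lfun2_bounded d (X : measurableType d) (m : {measure set X -> \bar R})
    (h : X -> R) (B : R) : (m setT < +oo)%E ->
  measurable_fun setT h -> (forall x, `|h x| <= B) -> h \in Lfun m 2%:E.
Proof.
move=> mfin mh hB; apply: Lfun2_of_sqr => //.
apply: (@le_lt_trans _ _ (\int[m]_x (B ^+ 2)%:E)%E).
  apply: ge0_le_integral => //.
  - by move=> t _; rewrite lee_fin sqr_ge0.
  - by apply/measurable_EFinP; exact: measurable_funX.
  - move=> t _; rewrite lee_fin -(real_normK (num_real (h t))).
    by rewrite ler_pXn2r ?nnegrE// (le_trans (normr_ge0 _) (hB t)).
rewrite integral_cst//= -ge0_fin_numE; last by rewrite mule_ge0// lee_fin sqr_ge0.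
by rewrite fin_numM// ge0_fin_numE.
Qed.

Lemma leb_pi_setT_fin : (mu setT < +oo)%E.
Proof. by rewrite -ge0_fin_numE// fin_num_measure. Qed.

Lemma cexp_L2pred a : cexp a \in @L2pred R.
Proof.
have [m1 m2] := cexp_cmeasurable a.
by apply/asboolP; split; apply: (Lfun2_bounded leb_pi_setT_fin (B := 1)) => // x /=;
  [exact: cos_max|exact: sin_max].
Qed.

(** Normalises the exponentials, whose squared norm is 2 pi. *)
Definition kappa : R := (Num.sqrt (2 * pi))^-1.

Lemma kappa2 : kappa ^+ 2 = (2 * pi)^-1.
Proof. by rewrite /kappa exprVn sqr_sqrtr// mulr_ge0// pi_ge0. Qed.

Lemma expi_subproof a : kappa%:C *: (cexp a : R -> R[i]) \in @L2pred R.
Proof. by apply: rpredZ; exact: cexp_L2pred. Qed.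

Definition expi a : L2 R := \pi_(L2 R) (MkL2fun (expi_subproof a)).

Lemma L2fct_expi a : {ae mu, forall t, L2fct (expi a) t = kappa%:C * cexp a t}.
Proof. exact: L2fct_pi. Qed.

Lemma is_derive_sinM a (t : R) : is_derive t 1 (fun t => sin (a * t)) (cos (a * t) * a).
Proof.
apply: (@is_derive1_comp _ (@sin R) ( *%R a)).
by apply: is_derive_eq; rewrite /GRing.scale /= mulr1.
Qed.

Lemma is_derive_cosM a (t : R) : is_derive t 1 (fun t => cos (a * t)) (- sin (a * t) * a).
Proof.
apply: (@is_derive1_comp _ (@cos R) ( *%R a)).
by apply: is_derive_eq; rewrite /GRing.scale /= mulr1.
Qed.

Lemma is_derive_cos_primitive a (t : R) : a != 0 ->
  is_derive t 1 (fun t => a^-1 * sin (a * t)) (cos (a * t)).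
Proof.
move=> a0; have h := is_derive_sinM a t.
by apply: is_derive_eq; rewrite /GRing.scale /= mulrC mulfK.
Qed.

Lemma is_derive_sin_primitive a (t : R) : a != 0 ->
  is_derive t 1 (fun t => - a^-1 * cos (a * t)) (sin (a * t)).
Proof.
move=> a0; have h := is_derive_cosM a t.
by apply: is_derive_eq; rewrite /GRing.scale /= !mulNr mulrN opprK mulrC mulfK.
Qed.

Lemma cintegral_cexp a : a != 0 -> sin (a * pi) = 0 ->
  cintegral (cexp a) = 0.
Proof.
move=> a0 sa; apply/eqP; rewrite eq_complex /=; apply/andP; split; apply/eqP.
  rewrite (@integral_primitive _ _ _ (@continuous_cosM a)
    (fun x => @is_derive_cos_primitive _ x a0)).
  by rewrite mulrN sinN sa oppr0 subrr.
rewrite (@integral_primitive _ _ _ (@continuous_sinM a)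
  (fun x => @is_derive_sin_primitive _ x a0)).
by rewrite mulrN cosN subrr.
Qed.

Lemma inner_expi a b : inner (expi a) (expi b) = (kappa ^+ 2)%:C * cintegral (cexp (a - b)).
Proof.
have ic : cintegrable (cexp (a - b)).
  have := cintegrable_mul_conj (cexp_L2pred (a - b)) (cexp_L2pred 0).
  by congr cintegrable; apply/funext => t; rewrite cexp0 conjC1 mulr1.
rewrite -cintegralZ// /inner; apply: ae_eq_cintegral.
- exact: L2mul_cmeas.
- by apply: cintegrable_measurable; exact: cintegrableZ.
apply: aeS2 (L2fct_expi a) (L2fct_expi b) => t -> ->.
rewrite cexpD cexpN rmorphM /= conj_realC.
by rewrite mulrACA -rmorphM.
Qed.

Lemma inner_expi_self a : inner (expi a) (expi a) = 1.
Proof.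
rewrite inner_expi subrr; have -> : cintegral (cexp 0) = (2 * pi)%:C :> R[i].
  apply/eqP; rewrite eq_complex /=; apply/andP; split; apply/eqP.
    under eq_Rintegral do rewrite mul0r cos0.
    rewrite (@integral_primitive _ _ _ (@cst_continuous R R 1) (fun x => is_derive_id x 1)).
    by ring.
  under eq_Rintegral do rewrite mul0r sin0.
  rewrite (@integral_primitive _ _ _ (@cst_continuous R R 0)
    (fun x => is_derive_cst (0 : R) x 1)).
  by rewrite subrr.
by rewrite kappa2 -rmorphM mulVf// mulf_neq0// gt_eqF// pi_gt0.
Qed.

Lemma inner_expi_orth a b : a != b -> sin ((a - b) * pi) = 0 ->
  inner (expi a) (expi b) = 0.
Proof.
by move=> ab s0; rewrite inner_expi cintegral_cexp ?mulr0// subr_eq0.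
Qed.

Lemma sin_nat_pi n : sin (n%:R * pi) = 0 :> R.
Proof.
elim: n => [|n IH]; first by rewrite mul0r sin0.
by rewrite -natr1 mulrDl mul1r sinDpi IH oppr0.
Qed.

Lemma orthonormal_expi (a : nat -> R) : injective a ->
  (forall i j, sin ((a i - a j) * pi) = 0) -> orthonormal_family (fun i => expi (a i)).
Proof.
move=> ai sa i j; have [->|ij] := eqVneq i j; first exact: inner_expi_self.
by apply: inner_expi_orth => //; apply: contra_neq ij => /ai.
Qed.

Lemma sin_natB_pi i j : sin ((i%:R - j%:R) * pi) = 0 :> R.
Proof. by rewrite mulrBl sinB !sin_nat_pi mul0r mulr0 subrr. Qed.

Definition half_exp (n : nat) : L2 R := expi (n%:R + 2^-1).
Definition int_exp (k : nat) : L2 R := expi (- k%:R).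

Lemma half_exp_orthonormal : orthonormal_family half_exp.
Proof.
apply: orthonormal_expi => [i j /addIr/eqP|i j]; first by rewrite eqr_nat => /eqP.
by rewrite opprD addrACA subrr addr0 sin_natB_pi.
Qed.

Lemma int_exp_orthonormal : orthonormal_family int_exp.
Proof.
apply: orthonormal_expi => [i j /oppr_inj/eqP|i j]; first by rewrite eqr_nat => /eqP.
by rewrite -opprD mulNr sinN sin_natB_pi oppr0.
Qed.

Lemma cos_half_pi n : cos ((n%:R + 2^-1) * pi) = 0 :> R.
Proof. by rewrite mulrDl [2^-1 * _]mulrC cosDpihalf sin_nat_pi oppr0. Qed.

Lemma sgr_norm_le1 (t : R) : `|Num.sg t| <= 1.
Proof. by rewrite normr_sg; case: (t != 0). Qed.

Lemma sg_cexp_L2pred (t a : R) :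
  (fun s => (Num.sg (t - s))%:C * cexp a s) \in @L2pred R.
Proof.
have sgB (g : R -> R) : measurable_fun [set: R] g -> (forall s, `|g s| <= 1) ->
    (fun s => Num.sg (t - s) * g s) \in Lfun mu 2%:E.
  move=> mg g1; apply: (Lfun2_bounded leb_pi_setT_fin (B := 1)).
    exact: measurable_sg_sub.
  by move=> s; rewrite normrM mulr_ile1 ?normr_ge0 ?sgr_norm_le1.
have [m1 m2] := cexp_cmeasurable a.
apply/asboolP; split.
- rewrite (_ : (fun _ => _) = (fun s => Num.sg (t - s) * cos (a * s))).
    by apply: sgB => // s; exact: cos_max.
  by apply/funext => s /=; rewrite mul0r subr0.
- rewrite (_ : (fun _ => _) = (fun s => Num.sg (t - s) * sin (a * s))).
    by apply: sgB => // s; exact: sin_max.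
  by apply/funext => s /=; rewrite mul0r addr0.
Qed.

(** The boundary terms at -pi and pi combine to a multiple of cos(a pi); this is
    where the frequency being a half-integer matters. *)
Lemma cintegral_sg_cexp a t : - pi < t < pi -> a != 0 -> cos (a * pi) = 0 ->
  cintegral (fun s => (Num.sg (t - s))%:C * cexp (- a) s) =
  (0 +i* (2 / a)) * cexp (- a) t.
Proof.
move=> tpi a0 ca; have Na0 : - a != 0 by rewrite oppr_eq0.
apply/eqP; rewrite eq_complex /=; apply/andP; split; apply/eqP.
  under eq_Rintegral do rewrite mul0r subr0.
  rewrite (@integral_sg_primitive _ _ _ t tpi (@continuous_cosM (- a))
    (fun x => @is_derive_cos_primitive _ x Na0)).
  by rewrite invrN !mulrN !mulNr opprK !sinN; ring.
under eq_Rintegral do rewrite mul0r addr0.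
rewrite (@integral_sg_primitive _ _ _ t tpi (@continuous_sinM (- a))
  (fun x => @is_derive_sin_primitive _ x Na0)).
by rewrite invrN !mulrN !mulNr !opprK !cosN ca; ring.
Qed.

End Exponentials.

(** * Kernels of the finite sections *)

Section TruncatedKernel.
Context (R : realType).
Local Notation mu := (@leb_pi R).
Implicit Types (s : nat -> R).

Lemma cintegral_sum (N : nat) (F : nat -> R -> R[i]) :
  (forall i, cintegrable (F i)) ->
  cintegrable (fun t => \sum_(0 <= i < N) F i t) /\
  cintegral (fun t => \sum_(0 <= i < N) F i t) = \sum_(0 <= i < N) cintegral (F i).
Proof.
move=> iF; elim: N => [|N [i1 i2]].
  have e0 : (fun t : R => \sum_(0 <= i < 0) F i t) = fun t => 0 * F 0%N t.
    by apply/funext => t; rewrite big_geq// mul0r.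
  by rewrite e0; split; [exact: cintegrableZ|rewrite cintegralZ// mul0r big_geq].
have eS : (fun t => \sum_(0 <= i < N.+1) F i t) =
    fun t => \sum_(0 <= i < N) F i t + F N t.
  by apply/funext => t; rewrite big_nat_recr.
by rewrite eS; split; [exact: cintegrableD|rewrite cintegralD// i2 big_nat_recr].
Qed.

Lemma L2fct_sum (N : nat) (c : nat -> R[i]) (w : nat -> L2 R) :
  {ae mu, forall t, L2fct (\sum_(0 <= i < N) c i *: w i) t =
    \sum_(0 <= i < N) c i * L2fct (w i) t}.
Proof.
elim: N => [|N IH].
  apply: aeS (L2fctZ 0 (0 : L2 R)) => t; rewrite scale0r mul0r => e.
  by rewrite !big_geq.
pose S := \sum_(0 <= i < N) c i *: w i.
have h : {ae mu, forall t, L2fct (S + c N *: w N) t = L2fct S t + c N * L2fct (w N) t}.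
  by apply: aeS2 (L2fctD S (c N *: w N)) (L2fctZ (c N) (w N)) => t -> ->.
by apply: aeS2 IH h => t IH h; rewrite !big_nat_recr//= -IH.
Qed.

Lemma L2pred_conj (f : R -> R[i]) : f \in @L2pred R ->
  (fun t => (f t)^*%R) \in @L2pred R.
Proof.
move=> /asboolP[f1 f2]; apply/asboolP; split.
  by rewrite (_ : (fun _ => _) = (fun t => complex.Re (f t)))//; apply/funext => t; case: (f t).
rewrite (_ : (fun _ => _) = - (fun t => complex.Im (f t)) :> (R -> R)).
  exact: Lfun_oppr_closed.
by apply/funext => t; rewrite !fctE; case: (f t).
Qed.

Lemma cintegrable_mul (f g : R -> R[i]) : f \in @L2pred R -> g \in @L2pred R ->
  cintegrable (fun t => f t * g t).
Proof.
move=> hf /L2pred_conj/(cintegrable_mul_conj hf).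
by congr cintegrable; apply/funext => t; rewrite conjCK.
Qed.

Lemma ae_Ipi : {ae mu, forall t, - pi < t < pi}.
Proof.
exists (~` @Ipi R); split.
- by apply: measurableC; exact: measurable_Ipi.
- change (lebesgue_measure (~` @Ipi R `&` @Ipi R) = 0%E).
  by rewrite setICl measure0.
- by move=> t /=; rewrite /Ipi /= in_itv.
Qed.

Lemma inner_expi_r (u : L2 R) a :
  inner u (expi a) = (kappa R)%:C * cintegral (fun t => cexp (- a) t * L2fct u t).
Proof.
have i1 := cintegrable_mul (cexp_L2pred (- a)) (L2fctP u).
rewrite -cintegralZ// /inner; apply: ae_eq_cintegral.
- exact: L2mul_cmeas.
- by apply: cintegrable_measurable; exact: cintegrableZ.
apply: aeS (L2fct_expi a) => t ->.
by rewrite rmorphM /= conj_realC cexpN; ring.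
Qed.

(** The kernel of the N-th section in the half-integer exponentials; it depends on
    t - s only. *)
Definition trig_kernel s N (ts : R * R) : R[i] :=
  \sum_(0 <= i < N) (s i * kappa R ^+ 2)%:C * cexp (i%:R + 2^-1) (ts.1 - ts.2).

Lemma trig_kernel_sq_integrable s N :
  sq_integrable (@leb_pi R \x @leb_pi R)%E (trig_kernel s N).
Proof.
have l12 : (1 <= 2%:E :> \bar R)%E by rewrite lee_fin ler1n.
have [L0 LL] := Lfun_submod_closed (@leb_pi R \x @leb_pi R)%E l12.
have mfin : ((@leb_pi R \x @leb_pi R) setT < +oo)%E.
  rewrite -setXTT product_measure1E//.
  by rewrite -ge0_fin_numE ?mule_ge0// fin_numM// fin_num_measure.
have L (g : R -> R) : continuous g -> (forall x, `|g x| <= 1) ->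
    (fun ts : R * R => g (ts.1 - ts.2)) \in Lfun (@leb_pi R \x @leb_pi R)%E 2%:E.
  move=> cg g1; apply: (Lfun2_bounded mfin (B := 1)) => //.
  apply: (measurableT_comp (continuous_measurable_fun cg)).
  by apply: measurable_funB; [exact: measurable_fst|exact: measurable_snd].
elim: N => [|N [IH1 IH2]]; rewrite /sq_integrable.
  by split; rewrite (_ : (fun _ => _) = 0)//; apply/funext => ts; rewrite /trig_kernel big_geq.
split.
- rewrite (_ : (fun _ => _) = (s N * kappa R ^+ 2) *:
      (fun ts : R * R => cos ((N%:R + 2^-1) * (ts.1 - ts.2))) +
      (fun t => complex.Re (trig_kernel s N t)) :> (R * R -> R)).
    apply: LL => //; apply: (L (fun x => cos ((N%:R + 2^-1) * x))) => [|x].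
      exact: continuous_cosM.
    exact: cos_max.
  apply/funext => ts; rewrite !fctE /trig_kernel big_nat_recr//=.
  by case: (\sum_(0 <= i < N) _) => x y /=; rewrite /GRing.scale /=; ring.
- rewrite (_ : (fun _ => _) = (s N * kappa R ^+ 2) *:
      (fun ts : R * R => sin ((N%:R + 2^-1) * (ts.1 - ts.2))) +
      (fun t => complex.Im (trig_kernel s N t)) :> (R * R -> R)).
    apply: LL => //; apply: (L (fun x => sin ((N%:R + 2^-1) * x))) => [|x].
      exact: continuous_sinM.
    exact: sin_max.
  apply/funext => ts; rewrite !fctE /trig_kernel big_nat_recr//=.
  by case: (\sum_(0 <= i < N) _) => x y /=; rewrite /GRing.scale /=; ring.
Qed.

Lemma trig_kernel_diag s N :
  kernel_of (trig_kernel s N) (diag_sum (@half_exp R) s N).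
Proof.
move=> u.
have all_exp : {ae mu, forall t, forall i,
    L2fct (half_exp R i) t = (kappa R)%:C * cexp (i%:R + 2^-1) t}.
  by apply/ae_foralln => i; exact: L2fct_expi.
apply: aeS2 (L2fct_sum N (fun i => (s i)%:C * inner u (half_exp R i)) (@half_exp R)) all_exp.
move=> t -> ht.
pose F i x := (s i * kappa R ^+ 2)%:C * cexp (i%:R + 2^-1) t *
  (cexp (- (i%:R + 2^-1)) x * L2fct u x).
have iF0 i : cintegrable (fun x => cexp (- (i%:R + 2^-1)) x * L2fct u x).
  by apply: cintegrable_mul; [exact: cexp_L2pred|exact: L2fctP].
have iF i : cintegrable (F i) by exact: cintegrableZ.
rewrite (_ : (fun x => _) = (fun x => \sum_(0 <= i < N) F i x)); last first.
  apply/funext => x; rewrite /trig_kernel mulr_suml; apply: eq_bigr => i _.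
  by rewrite /F cexp_sub; ring.
rewrite (cintegral_sum N iF).2; apply: eq_bigr => i _.
rewrite ht /F cintegralZ// inner_expi_r.
by rewrite [(s i * _)%:C]rmorphM /= rmorphXn /=; ring.
Qed.

Definition trunc_eigenvalue s N k : R :=
  \sum_(0 <= i < N) s i / (pi * (i%:R + 2^-1 + k%:R)).

(** With w = n + 1/2 + k, the product of e^(i(n+1/2)t) with the factor e^(-iwt)
    from [cintegral_sg_cexp] is e^(-ikt) for every n. So all the terms of the
    kernel map the k-th integer exponential to multiples of itself. *)
Lemma truncated_eigenvector s N (A : L2 R -> L2 R) k :
  kernel_of (fun ts => (Num.sg (ts.1 - ts.2))%:C * trig_kernel s N ts) A ->
  A (int_exp R k) = (0 +i* trunc_eigenvalue s N k) *: int_exp R k.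
Proof.
move=> kA; apply: L2_ext.
have h := aeS2 (fun t h1 h2 => conj h1 h2) (kA (int_exp R k)) ae_Ipi.
have h' := aeS2 (fun t h1 h2 => conj h1 h2)
  (L2fctZ (0 +i* trunc_eigenvalue s N k) (int_exp R k)) (L2fct_expi (- k%:R)).
apply: aeS2 h h' => t [-> tpi] [-> ->].
pose a i : R := i%:R + 2^-1.
(* The term of index [i] with its dependence on [t] taken out of the integral. *)
pose F i x := (s i * kappa R ^+ 2)%:C * cexp (a i) t * (kappa R)%:C *
  ((Num.sg (t - x))%:C * cexp (- (a i + k%:R)) x).
have iF0 b : cintegrable (fun x => (Num.sg (t - x))%:C * cexp b x).
  have := cintegrable_mul (sg_cexp_L2pred t b) (cexp_L2pred 0).
  by congr cintegrable; apply/funext => x; rewrite cexp0 mulr1.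
have iF i : cintegrable (F i) by apply: cintegrableZ; exact: iF0.
have a0 i : a i + k%:R != 0.
  rewrite gt_eqF// /a; have : (0 : R) <= i%:R by []; have : (0 : R) <= k%:R by [].
  by lra.
rewrite (@ae_eq_cintegral _ _ (fun x => \sum_(0 <= i < N) F i x)); first last.
- apply: aeS (L2fct_expi (- k%:R)) => x /= ->.
  rewrite /trig_kernel !(mulr_sumr, mulr_suml); apply: eq_bigr => i _ /=.
  by rewrite /F /a cexp_sub [- (_ + k%:R)]opprD
    (cexpD (- (i%:R + 2^-1))); ring.
- by apply: cintegrable_measurable; exact: (cintegral_sum N iF).1.
- pose G i x := (s i * kappa R ^+ 2)%:C * cexp (a i) t *
    ((Num.sg (t - x))%:C * cexp (- a i) x * L2fct (int_exp R k) x).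
  have iG i : cintegrable (G i).
    apply: cintegrableZ; apply: (cintegrable_mul (sg_cexp_L2pred t (- a i))).
    exact: L2fctP.
  have := cintegrable_measurable (cintegral_sum N iG).1; congr cmeasurable.
  apply/funext => x; rewrite /trig_kernel mulr_sumr mulr_suml; apply: eq_bigr => i _.
  by rewrite /G /a cexp_sub /=; ring.
rewrite (cintegral_sum N iF).2.
have -> : (0 +i* trunc_eigenvalue s N k) =
    \sum_(0 <= i < N) (0 +i* (s i / (pi * (a i + k%:R)))) :> R[i].
  rewrite /trunc_eigenvalue; elim: (N) => [|M IH]; first by rewrite !big_geq.
  by rewrite !big_nat_recr//= -IH; apply/eqP; rewrite eq_complex /= addr0 !eqxx.
rewrite mulr_suml; apply: eq_bigr => i _.
rewrite /F cintegralZ// cintegral_sg_cexp//; last first.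
  by rewrite mulrDl cosD cos_half_pi sin_nat_pi mul0r mulr0 subrr.
have -> : cexp (- k%:R) t = cexp (a i) t * cexp (- (a i + k%:R)) t.
  by rewrite -cexpD; congr cexp; ring.
have -> : 0 +i* (s i / (pi * (a i + k%:R))) =
    (s i * kappa R ^+ 2)%:C * (0 +i* (2 / (a i + k%:R))) :> R[i].
  apply/eqP; rewrite eq_complex /= kappa2 !(mul0r, mulr0, subr0, addr0) eqxx /=.
  have key (p : R) : p != 0 -> s i / (p * (a i + k%:R)) =
      s i * (2 * p)^-1 * (2 / (a i + k%:R)).
    by move=> p0; field; rewrite a0 p0.
  by apply/eqP/key; rewrite gt_eqF// pi_gt0.
by ring.
Qed.

End TruncatedKernel.

(** * Rearrangements and logarithmic sums *)

Section Rearrangement.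
Context (R : realType).
Implicit Types (x : nat -> R[i]) (s : nat -> R).

Lemma sup_ge0 (A : set R) : (forall y, A y -> 0 <= y) -> 0 <= sup A.
Proof.
move=> A0; have [hs|/sup_out->//] := pselect (has_sup A).
by have [[y Ay] _] := hs; apply: le_trans (A0 _ Ay) (sup_upper_bound hs Ay).
Qed.

Lemma rearrangement_ge0_set x (F : {fset nat}) :
  0 <= sup [set normc (x k) | k in [set k | k \notin F]].
Proof. by apply: sup_ge0 => _ [k _ <-]; exact: normc_ge0. Qed.

Lemma rearrangement_noninc x m n : (m <= n)%N -> rearrangement x n <= rearrangement x m.
Proof.
move=> mn; apply: lb_le_inf.
  by exists (sup [set normc (x k) | k in [set k | k \notin (fset0 : {fset nat})]]);
    exists fset0 => //=; rewrite cardfs0.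
move=> _ [F Fm <-]; apply: ge_inf.
  by exists 0 => _ [G _ <-]; exact: rearrangement_ge0_set.
by exists F => //=; exact: leq_trans mn.
Qed.

Lemma rearrangement_ge0 x n : 0 <= rearrangement x n.
Proof.
apply: lb_le_inf.
  by exists (sup [set normc (x k) | k in [set k | k \notin (fset0 : {fset nat})]]);
    exists fset0 => //=; rewrite cardfs0.
by move=> _ [F _ <-]; exact: rearrangement_ge0_set.
Qed.

Definition log_summable s := (log_sum s < +oo)%E.

Lemma log_sum_ge0_terms s : (forall n, 0 <= s n) ->
  forall n : nat, (0 <= (s n / n.+1%:R)%:E)%E.
Proof. by move=> s0 n; rewrite lee_fin divr_ge0. Qed.

Lemma log_sum_le s u : (forall n, 0 <= u n <= s n) -> (log_sum u <= log_sum s)%E.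
Proof.
move=> us; apply: lee_nneseries => n; rewrite ?lee_fin.
  by move=> _ _; apply: divr_ge0 => //; have /andP[] := us n.
by move=> _; rewrite ler_wpM2r// ?invr_ge0//; have /andP[] := us n.
Qed.

(** Otherwise [s] would be bounded below by a positive constant, against the
    divergence of the harmonic series. *)
Lemma log_summable_cvg0 s : (forall n, 0 <= s n) ->
  (forall m n, (m <= n)%N -> s n <= s m) -> log_summable s -> s @ \oo --> 0.
Proof.
move=> s0 sm ls.
have cs : s @ \oo --> inf (range s).
  apply: nonincreasing_cvgn => //.
  by exists 0 => _ [n _ <-].
have i0 : 0 <= inf (range s).
  by apply: lb_le_inf; [exists (s 0%N), 0%N|move=> _ [n _ <-]].
suff -> : 0 = inf (range s) by [].
apply/eqP; rewrite eq_le i0 /= leNgt; apply/negP => ip.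
set l := inf (range s) in ip.
have ls' n : l <= s n.
  by apply: ge_inf; [exists 0 => _ [k _ <-]|exists n].
apply: (@dvg_harmonic R); apply: nondecreasing_is_cvgn.
  by apply: nondecreasing_series => n _ _; rewrite /harmonic /= invr_ge0.
exists (l^-1 * fine (log_sum s)) => _ [n _ <-].
rewrite -(ler_pM2l ip) mulrA mulfV ?gt_eqF// mul1r.
have lsf : log_sum s \is a fin_num.
  by rewrite ge0_fin_numE//; apply: nneseries_ge0 => k _ _; exact: log_sum_ge0_terms.
rewrite -lee_fin fineK//.
apply: le_trans (nneseries_lim_ge n _); last by move=> k _ _; exact: log_sum_ge0_terms.
rewrite sumEFin lee_fin /series /= mulr_sumr; apply: ler_sum => k _.
by rewrite ler_wpM2r// ?invr_ge0.
Qed.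

(** Split the sum at a large [M]: beyond [M] the shifted terms are bounded by the
    tail of the original series, and the first [M] terms by [s N] each. *)
Lemma log_sum_shift_small s : decreasing_to0 s -> log_summable s ->
  forall e : R, 0 < e -> exists N0, forall N, (N0 <= N)%N ->
    (log_sum (fun i => s (i + N)%N) <= e%:E)%E.
Proof.
move=> ds ls e e0.
have s0 n : 0 <= s n by exact: decreasing_to0_ge0.
have e20 : 0 < e / 2 by rewrite divr_gt0.
have t0 n : (0 <= (s n / n.+1%:R)%:E)%E by exact: log_sum_ge0_terms.
have [M tM] : exists M, (\sum_(M <= k <oo) (s k / k.+1%:R)%:E <= (e / 2)%:E)%E.
  have := nneseries_tail_cvg ls (fun k _ => t0 k).
  move=> /fine_cvgP[fin /cvgrPdist_le/(_ _ e20)] h.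
  have [M _ /(_ _ (leqnn M)) [f1 f2]] := filterI fin h.
  exists M; rewrite -(fineK f1) lee_fin.
  by move: f2; rewrite sub0r normrN; apply: le_trans; exact: ler_norm.
have Me : 0 < e / 2 / M.+1%:R by rewrite divr_gt0.
have [_ /cvgrPdist_le/(_ _ Me)[N0 _ hN0]] := ds.
exists N0 => N NN.
have sN : s N <= e / 2 / M.+1%:R.
  by have := hN0 _ NN; rewrite sub0r normrN ger0_norm.
rewrite /log_sum (nneseries_split 0 M)/=; last first.
  by move=> k _; rewrite lee_fin divr_ge0.
rewrite (splitr e) EFinD leeD//.
  rewrite sumEFin lee_fin add0n.
  apply: (@le_trans _ _ (\sum_(0 <= i < M) (e / 2 / M.+1%:R))).
    apply: ler_sum => i _; apply: le_trans sN.
    rewrite ler_pdivrMr// (le_trans (ds.1 N (i + N)%N _)) ?leq_addl//.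
    by rewrite ler_peMr// ler1n.
  rewrite sumr_const_nat subn0 -[_ *+ M]mulr_natr [leLHS]mulrAC ler_pdivrMr//.
  by rewrite ler_wpM2l ?(ltW e20)// ler_nat.
apply: le_trans tM; apply: lee_nneseries => k; rewrite ?lee_fin.
  by move=> _ _; rewrite divr_ge0.
by move=> _; rewrite ler_wpM2r ?invr_ge0//; apply: ds.1; exact: leq_addr.
Qed.

End Rearrangement.

(** * Comparison with the Calderon operator *)

Section EigenvalueBounds.
Context (R : realType).
Implicit Types (s : nat -> R).

Lemma freq_gt0 i k : 0 < pi * (i%:R + 2^-1 + k%:R) :> R.
Proof.
by rewrite mulr_gt0 ?pi_gt0.
Qed.

Lemma trunc_eigenvalue_noninc s N k n : (forall i, 0 <= s i) -> (k <= n)%N ->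
  trunc_eigenvalue s N n <= trunc_eigenvalue s N k.
Proof.
move=> s0 kn; apply: ler_sum => i _; rewrite ler_wpM2l// lef_pV2 ?posrE ?freq_gt0//.
by rewrite ler_pM2l ?pi_gt0// lerD2l ler_nat.
Qed.

Lemma trunc_eigenvalue_ge0 s N k : (forall i, 0 <= s i) -> 0 <= trunc_eigenvalue s N k.
Proof. by move=> s0; apply: sumr_ge0 => i _; rewrite divr_ge0// ltW// freq_gt0. Qed.

Lemma two_pi_weight (y w : R) : 2 * pi * (y / (pi * w)) = y * (2 / w).
Proof.
rewrite invfM mulrCA; congr (_ * _); rewrite mulrA mulfK//.
by rewrite gt_eqF// pi_gt0.
Qed.

Lemma calderon_head_le s N n : (forall i, 0 <= s i) -> (n < N)%N ->
  n.+1%:R^-1 * (\sum_(0 <= k < n.+1) s k) <= 2 * pi * trunc_eigenvalue s N n.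
Proof.
move=> s0 nN; rewrite mulr_sumr /trunc_eigenvalue (big_cat_nat (n := n.+1) (p := N))//=.
rewrite [leRHS]mulrDr -[leLHS]addr0 lerD//; last first.
  rewrite !mulr_ge0 ?pi_ge0//; apply: sumr_ge0 => i _.
  by rewrite divr_ge0// ltW// freq_gt0.
rewrite mulr_sumr big_nat [leRHS]big_nat; apply: ler_sum => i /andP[_ i_n].
rewrite two_pi_weight mulrC ler_wpM2l//.
have w0 : (0 : R) < i%:R + 2^-1 + n%:R.
  by have : (0 : R) <= i%:R by []; have : (0 : R) <= n%:R by []; lra.
rewrite ler_pdivlMr// mulrC ler_pdivrMr//.
have : (i%:R : R) <= n%:R by rewrite ler_nat.
by rewrite -[n.+1%:R]natr1; lra.
Qed.

Lemma calderon_tail_le s N n : (forall i, 0 <= s i) ->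
  \sum_(n <= k < N) s k / k.+1%:R <= 2 * pi * trunc_eigenvalue s N n.
Proof.
move=> s0; have [nN|Nn] := leqP n N; last first.
  by rewrite big_geq ?(ltnW Nn)// !mulr_ge0 ?pi_ge0 ?trunc_eigenvalue_ge0.
rewrite /trunc_eigenvalue (big_cat_nat (m := 0%N) (n := n) (p := N))//=.
rewrite [leRHS]mulrDr -[leLHS]add0r lerD//.
  rewrite !mulr_ge0 ?pi_ge0//; apply: sumr_ge0 => i _.
  by rewrite divr_ge0// ltW// freq_gt0.
rewrite mulr_sumr big_nat [leRHS]big_nat; apply: ler_sum => i /andP[n_i _].
rewrite two_pi_weight ler_wpM2l//.
have w0 : (0 : R) < i%:R + 2^-1 + n%:R.
  by have : (0 : R) <= i%:R by []; have : (0 : R) <= n%:R by []; lra.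
rewrite ler_pdivlMr// mulrC ler_pdivrMr//.
have : (n%:R : R) <= i%:R by rewrite ler_nat.
by rewrite -[i.+1%:R]natr1; lra.
Qed.

End EigenvalueBounds.

(** * Passage to the limit *)

Section MainTheorem.
Context (R : realType).
Implicit Types (s : nat -> R).

Lemma Lambda_log_diagonal w s A : @orthonormal_family R w -> decreasing_to0 s ->
  log_summable s -> diag_op w s A -> Lambda_log_op A.
Proof.
move=> ow ds ls dA; split; first exact: diagonal_bounded dA.
rewrite (_ : singular_value A = s)//; apply/funext => n.
exact: singular_value_diagonal ow ds dA.
Qed.

Lemma truncate_log_summable s N : decreasing_to0 s -> log_summable s ->
  log_summable (truncate s N).
Proof.
move=> ds; apply: le_lt_trans; apply: log_sum_le => n; rewrite /truncate.
have sn := decreasing_to0_ge0 n ds.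
by case: ifP => _; rewrite ?lexx sn.
Qed.

Lemma shift_decreasing s N : decreasing_to0 s -> decreasing_to0 (fun i => s (i + N)%N).
Proof.
move=> [sm s0]; split; first by move=> m n mn; apply: sm; rewrite leq_add2r.
by rewrite (cvg_shiftn N s).
Qed.

Lemma shift_log_summable s N : decreasing_to0 s -> log_summable s ->
  log_summable (fun i => s (i + N)%N).
Proof.
move=> ds; apply: le_lt_trans; apply: log_sum_le => n.
by rewrite decreasing_to0_ge0//= ds.1// leq_addr.
Qed.

Context (T : (L2 R -> L2 R) -> L2 R -> L2 R) (hT : triangular_truncation T).

(** The remainder is diagonal with shifted entries, so its logarithmic norm is
    small, and [T] is bounded for this norm. *)
Lemma opnorm_truncation_remainder s A e : decreasing_to0 s -> log_summable s ->
  diag_op (@half_exp R) s A -> 0 < e ->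
  exists N0, forall N, (N0 <= N)%N ->
    opnorm (T (A - diag_sum (@half_exp R) s N)) <= e.
Proof.
move=> ds ls dA e0; have [_ _ [C hC] _] := hT.
have c0 : 0 < `|C| + 1 by rewrite ltr_wpDl.
have ec0 : 0 < e / (`|C| + 1) by rewrite divr_gt0.
(* The constant [C] may be negative; [`|C| + 1] is a positive upper bound. *)
have [N0 hN0] := log_sum_shift_small ds ls ec0.
exists N0 => N /hN0 hN.
have ow : orthonormal_family (fun i => half_exp R (i + N)%N).
  by move=> i j; rewrite half_exp_orthonormal eqn_add2r.
have dr := diagonal_remainder N dA.
have dsN := shift_decreasing N ds.
have Lr := Lambda_log_diagonal ow dsN (shift_log_summable N ds ls) dr.
have := hC _ Lr.
rewrite (_ : singular_value _ = fun i => s (i + N)%N); last first.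
  by apply/funext => n; exact: singular_value_diagonal ow dsN dr.
move=> /le_trans h; rewrite -lee_fin; apply: h.
have l0 : (0 <= log_sum (fun i => s (i + N)%N))%E.
  by apply: nneseries_ge0 => n _ _; exact: (log_sum_ge0_terms (fun k => decreasing_to0_ge0 k dsN)).
apply: (@le_trans _ _ ((`|C| + 1)%:E * log_sum (fun i => s (i + N)%N))%E).
  by rewrite lee_wpmul2r// lee_fin (le_trans (ler_norm C))// lerDl.
apply: le_trans (lee_wpmul2l _ hN) _; first by rewrite lee_fin ltW.
by rewrite -EFinM lee_fin mulrC divfK// gt_eqF.
Qed.

(** On the span of the first n + 1 integer exponentials the truncated section
    multiplies each vector by a number of modulus at least the n-th eigenvalue,
    and the truncated remainder perturbs this by at most its norm. *)
Lemma truncation_singular_value_ge s A n N : decreasing_to0 s -> log_summable s ->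
  diag_op (@half_exp R) s A ->
  trunc_eigenvalue s N n - opnorm (T (A - diag_sum (@half_exp R) s N)) <=
  singular_value (T A) n.
Proof.
move=> ds ls dA; have [Tb Tl _ Tk] := hT.
have oh := @half_exp_orthonormal R; have oi := @int_exp_orthonormal R.
pose AN := diag_sum (@half_exp R) s N.
have LA := Lambda_log_diagonal oh ds ls dA.
have LN : Lambda_log_op AN.
  apply: Lambda_log_diagonal oh (truncate_decreasing N ds) _ (diagonal_truncate N oh ds).
  exact: truncate_log_summable.
have Lr : Lambda_log_op (A - AN).
  apply: Lambda_log_diagonal (shift_decreasing N ds) _ (diagonal_remainder N dA).
    by move=> i j; rewrite oh eqn_add2r.
  exact: shift_log_summable.
have TA : T A = T AN + T (A - AN).
  by rewrite -[T AN]scale1r -Tl// scale1r addrC subrK.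
have s0 i : 0 <= s i by exact: decreasing_to0_ge0.
have [lTN _] := Tb _ LN; have [_ _ TZ TS] := linear_opE lTN.
apply: (singular_value_ge (Tb _ LA) oi) => a /=.
set v := \sum_(0 <= i < n.+1) _.
have ev : T AN v = \sum_(0 <= k < n.+1) (a k * (0 +i* trunc_eigenvalue s N k)) *: int_exp R k.
  rewrite TS; apply: eq_bigr => k _; rewrite TZ -scalerA; congr (_ *: _).
  apply: truncated_eigenvector; apply: Tk; first exact: trig_kernel_sq_integrable.
  exact: trig_kernel_diag.
have lb : trunc_eigenvalue s N n * L2norm v <= L2norm (T AN v).
  rewrite ev -(@ler_pXn2r _ 2)// ?nnegrE ?mulr_ge0 ?L2norm_ge0 ?trunc_eigenvalue_ge0//.
  rewrite exprMn !L2norm_orthonormal_sum ?iota_uniq// mulr_sumr big_nat [leRHS]big_nat.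
  apply: ler_sum => k /andP[_ kn].
  have -> : normc (a k * (0 +i* trunc_eigenvalue s N k)) =
      trunc_eigenvalue s N k * normc (a k).
    by rewrite normcM mulrC /= expr0n /= add0r sqrtr_sqr ger0_norm// trunc_eigenvalue_ge0.
  rewrite exprMn ler_wpM2r ?sqr_ge0// ler_pXn2r ?nnegrE ?trunc_eigenvalue_ge0//.
  exact: trunc_eigenvalue_noninc.
rewrite TA fctE mulrBl; apply: le_trans (lerB lb (opnormP (Tb _ Lr) v)) _.
exact: L2normB_le.
Qed.

(** The cut Calderon sums are at most 4 pi times the eigenvalue. Each bound holds up
    to an error [e] for all large [N], which also shows that the tail series of
    the Calderon operator converges. *)
Lemma calderon_le_truncation s A n : decreasing_to0 s -> log_summable s ->
  diag_op (@half_exp R) s A ->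
  (8 * pi)^-1 * Calderon s n <= singular_value (T A) n.
Proof.
move=> ds ls dA; have s0 i : 0 <= s i by exact: decreasing_to0_ge0.
pose P N := \sum_(n <= k < N) s k / k.+1%:R.
pose a := n.+1%:R^-1 * (\sum_(0 <= k < n.+1) s k).
set sv := singular_value (T A) n.
have p8 : 0 < 8 * pi :> R by rewrite mulr_gt0// pi_gt0.
have Pm : {homo P : i j / (i <= j)%N >-> i <= j}.
  move=> i j ij; rewrite /P; have [ni|ni] := leqP n i.
    rewrite [leRHS](big_cat_nat (n := i))//= lerDl.
    by apply: sumr_ge0 => k _; rewrite divr_ge0.
  by rewrite big_geq ?(ltnW ni)//; apply: sumr_ge0 => k _; rewrite divr_ge0.
have PB (e : R) : 0 < e -> \forall N \near \oo, P N <= 8 * pi * (sv + e) - a.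
  move=> e0; have [N0 hN0] := opnorm_truncation_remainder ds ls dA e0.
  exists (maxn N0 n.+1) => // N; rewrite /= geq_max => /andP[NN nN].
  have h1 := calderon_head_le s0 nN; have h2 := calderon_tail_le N n s0.
  have h3 := truncation_singular_value_ge n N ds ls dA.
  have h4 := hN0 _ NN.
  have d0 := trunc_eigenvalue_ge0 N n s0.
  have h5 : trunc_eigenvalue s N n <= sv + e.
    by move: h3; rewrite -/sv; lra.
  rewrite lerBrDr; apply: le_trans (lerD h2 h1) _.
  rewrite -mulrDr -mulrA.
  have := pi_gt0 R; move: (pi : R) => p p0.
  nra.
have cP : cvgn P.
  apply: nondecreasing_is_cvgn => //.
  have [N0 _ hN0] := PB 1 ltr01.
  exists (8 * pi * (sv + 1) - a) => _ [N _ <-].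
  apply: le_trans (Pm _ _ (leq_maxl N N0)) _.
  by apply: hN0; exact: leq_maxr.
rewrite mulrC ler_pdivrMr// [leRHS]mulrC.
have -> : Calderon s n = a + limn P by [].
apply/ler_addgt0Pr => e e0.
have e8 : 0 < e / (8 * pi) by rewrite divr_gt0.
rewrite addrC -lerBrDr; apply: limr_le => //.
apply: filterS (PB _ e8) => N; rewrite mulrDr.
by rewrite (mulrC (8 * pi) (e / _)) divfK// gt_eqF.
Qed.

End MainTheorem.

Theorem theorem1 (R : realType) (T : (L2 R -> L2 R) -> L2 R -> L2 R)
    (hT : triangular_truncation T) (x : nat -> complex R)
    (hx : Lambda_log_seq x) :
  exists a : L2 R -> L2 R,
    [/\ bounded_op a,
        forall n : nat, singular_value a n = rearrangement x n
      & forall n : nat,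
          (8 * pi)^-1 * Calderon (rearrangement x) n <= singular_value (T a) n].
Proof.
have [_ ls] := hx.
have ds : decreasing_to0 (rearrangement x).
  split; first exact: rearrangement_noninc.
  apply: log_summable_cvg0 ls; first exact: rearrangement_ge0.
  exact: rearrangement_noninc.
have oh := @half_exp_orthonormal R.
have [A dA] := diagonal_exists oh ds.
exists A; split.
- exact: diagonal_bounded dA.
- by move=> n; exact: singular_value_diagonal oh ds dA.
- by move=> n; exact: (calderon_le_truncation hT n ds ls dA).
Qed.
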